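(* Let $(\mathcal X_n)_{n\in\bar{\mathbb N}}\subseteq\mathbb X_1$ be given, where $\bar{\mathbb N}:=\mathbb N\cup\{\infty\}$. Then $\mathcal X_n$ mG-converges to $\mathcal X_\infty$ if and only if $\mathsf d_{\rm mG}(\mathcal X_n,\mathcal X_\infty)\to 0$ as $n\to\infty$.
   Context: ''Isometry'' means distance-preserving map (not necessarily surjective). A normalised metric measure space $({\rm X},\mathsf d,\mathfrak m)$ is a complete separable metric space with a Borel probability measure $\mathfrak m$. Two such spaces are isomorphic if there is an isometric bijection $\phi\colon{\rm spt}(\mathfrak m_{\rm X})\to{\rm spt}(\mathfrak m_{\rm Y})$ with $\phi_\#\mathfrak m_{\rm X}=\mathfrak m_{\rm Y}$. $\mathbb X_1$ is the collection of isomorphism classes $[{\rm X},\mathsf d,\mathfrak m]$ of normalised metric measure spaces. mG-convergence: $[{\rm X}_n,\mathsf d_n,\mathfrak m_n]$ mG-converges to $[{\rm X}_\infty,\mathsf d_\infty,\mathfrak m_\infty]$ if there exist a complete separable metric space $({\rm Y},\mathsf d_{\rm Y})$ and isometries $\iota_n\colon{\rm X}_n\to{\rm Y}$, $n\in\bar{\mathbb N}$, such that $(\iota_n)_\#\mathfrak m_n$ converges weakly (in duality with bounded continuous functions) to $(\iota_\infty)_\#\mathfrak m_\infty$. $(\mathbb U,\mathsf d_{\mathbb U})$ is the Urysohn universal metric space: the unique (up to isometric bijection) complete separable metric space that is universal (every separable metric space embeds isometrically in it) and ultrahomogeneous (every isometry $\phi\colon F\to\mathbb U$ on a finite subset $F\subseteq\mathbb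 U$ extends to an isometric bijection of $\mathbb U$). $\mathscr P(\mathbb U)$ is the set of Borel probability measures on $\mathbb U$; $W(\mu,\nu):=\inf_{\pi}\int\mathsf d_{\mathbb U}\wedge 1\,{\rm d}\pi$, the infimum being over all $\pi\in\mathscr P(\mathbb U\times\mathbb U)$ with marginals $\mu$ and $\nu$. For $\mu,\nu\in\mathscr P(\mathbb U)$, $\mu\sim\nu$ iff $\phi_\#\mu=\nu$ for some isometric bijection $\phi\colon{\rm spt}(\mu)\to{\rm spt}(\nu)$; $\mathscr P_\sim(\mathbb U):=\mathscr P(\mathbb U)/\sim$, and for $\theta,\eta\in\mathscr P_\sim(\mathbb U)$ $$W_H(\theta,\eta):=\max\Big\{\sup_{\mu\in\theta}\inf_{\nu\in\eta}W(\mu,\nu),\ \sup_{\nu\in\eta}\inf_{\mu\in\theta}W(\mu,\nu)\Big\}.$$ The map $\Phi\colon\mathbb X_1\to\mathscr P_\sim(\mathbb U)$, $\Phi([{\rm X},\mathsf d,\mathfrak m]):=[f_\#\mathfrak m]$ for any isometry $f\colon{\rm X}\to\mathbb U$, is a well-defined bijection, and $\mathsf d_{\rm mG}(\mathcal X,\mathcal Y):=W_H(\Phi(\mathcal X),\Phi(\mathcal Y))$ for $\mathcal X,\mathcal Y\in\mathbb X_1$. *)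

(* Defs.v *)
From HB Require Import structures.
From mathcomp Require Import all_boot all_order all_algebra.
From mathcomp Require Import all_classical all_reals all_analysis.

Set Implicit Arguments.
Unset Strict Implicit.
Unset Printing Implicit Defensive.

Import Order.TTheory GRing.Theory Num.Theory.
Import numFieldNormedType.Exports.

Local Open Scope classical_set_scope.
Local Open Scope ring_scope.

(* Complete metric spaces. The library's [completeType] is pointed, so these
   spaces are nonempty, as is every space that carries a probability measure. *)
#[short(type="completeMetricType")]
HB.structure Definition CompleteMetric (R : numDomainType) :=
  {T of Complete T & Metric R T}.

Definition separable (T : topologicalType) :=
  exists2 D : set T, countable D & dense D.

(* Not necessarily surjective. *)
Definition isometry (R : realType) (X Y : metricType R) (f : X -> Y) :=
  forall x y, mdist (f x) (f y) = mdist x y.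

Definition isometry_on (R : realType) (X Y : metricType R) (D : set X)
    (f : X -> Y) :=
  {in D &, forall x y, mdist (f x) (f y) = mdist x y}.

(* T with its Borel sigma-algebra. *)
Notation borel T := (g_sigma_algebraType (@open T)).

Lemma continuous_borel_measurable (X Y : ptopologicalType) (f : X -> Y) :
  continuous f -> measurable_fun [set: borel X] (f : borel X -> borel Y).
Proof.
move=> /continuousP cf; apply: (@measurability _ _ (borel X) (borel Y) setT f (@open Y)) => //.
by move=> _ [V oV <-]; rewrite setTI; apply: sub_sigma_algebra; exact: cf.
Qed.

Lemma isometry_continuous (R : realType) (X Y : metricType R) (f : X -> Y) :
  isometry f -> continuous f.
Proof.
move=> isof x; apply/metricType_numDomainType.cvgrPdist_lt => e e0.
have := nbhsx_ballx x e e0; rewrite ballEmdist.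
by apply: filterS => y /=; rewrite isof.
Qed.

Lemma isometry_borel_measurable (R : realType) (X Y : completeMetricType R)
    (f : X -> Y) :
  isometry f -> measurable_fun [set: borel X] (f : borel X -> borel Y).
Proof. by move=> /isometry_continuous/continuous_borel_measurable. Qed.

Section pushforward_isometry.
Context (R : realType) (X Y : completeMetricType R).
Context (m : probability (borel X) R) (f : X -> Y) (isof : isometry f).

Definition isometry_mfun : {mfun borel X >-> borel Y} :=
  HB.pack (f : borel X -> borel Y)
    (isMeasurableFun.Build _ _ (borel X) (borel Y) f
      (isometry_borel_measurable isof)).

Definition isometry_pushforward : probability (borel Y) R :=
  distribution m isometry_mfun.

End pushforward_isometry.

Section support.
Context (R : realType).

Definition spt (X : completeMetricType R) (m : set (borel X) -> \bar R) : set X :=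
  [set x | forall V : set X, open V -> V x -> (0 < m V)%E].

(* An isometric bijection of the supports that carries m to n. The map phi is
   total, but only its values on spt m matter: its image measure is computed
   with m restricted to spt m. *)
Definition measure_isomorphic (X Y : completeMetricType R)
    (m : set (borel X) -> \bar R) (n : set (borel Y) -> \bar R) :=
  exists phi : X -> Y,
    [/\ set_bij (spt m) (spt n) phi,
        isometry_on (spt m) phi &
        forall A : set (borel Y), measurable A ->
          m (spt m `&` phi @^-1` A) = n A].

End support.

(* Normalised metric measure spaces. *)
Record nmms (R : realType) := Nmms {
  space :> completeMetricType R ;
  space_separable : separable space ;
  nmeas : probability (borel space) R }.

(* The isomorphism classes [X, d, m], as sets of spaces. *)
Definition iso_class (R : realType) (X : nmms R) : set (nmms R) :=
  [set Y | measure_isomorphic (nmeas X) (nmeas Y)].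

Definition X1 (R : realType) := {C : set (nmms R) | range (@iso_class R) C}.

Definition to_X1 (R : realType) (X : nmms R) : X1 R :=
  exist (range (@iso_class R)) (iso_class X) (ex_intro2 _ _ X I erefl).

Definition weak_cvg (R : realType) (Y : completeMetricType R)
    (mu : nat -> set (borel Y) -> \bar R) (muoo : set (borel Y) -> \bar R) :=
  forall f : Y -> R, continuous f -> (exists M, forall y, `|f y| <= M) ->
    (\int[mu n]_y (f y)%:E)%E @[n --> \oo] --> (\int[muoo]_y (f y)%:E)%E.

Definition mG_cvg (R : realType) (X : nat -> nmms R) (Xoo : nmms R) :=
  exists2 Y : completeMetricType R, separable Y &
  exists (iota : forall n, X n -> Y) (iotaoo : Xoo -> Y)
    (isoi : forall n, isometry (iota n)) (isoioo : isometry iotaoo),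
    weak_cvg (fun n => isometry_pushforward (nmeas (X n)) (isoi n))
             (isometry_pushforward (nmeas Xoo) isoioo).

Section urysohn.
Context (R : realType).

Definition universal (U : metricType R) :=
  forall S : metricType R, separable S -> exists f : S -> U, isometry f.

Definition ultrahomogeneous (U : metricType R) :=
  forall (F : set U) (phi : U -> U), finite_set F -> isometry_on F phi ->
    exists psi : U -> U,
      [/\ isometry psi, set_bij setT setT psi & {in F, psi =1 phi}].

Record urysohn (U : completeMetricType R) : Prop := Urysohn {
  urysohn_separable : separable U ;
  urysohn_universal : universal U ;
  urysohn_ultrahomogeneous : ultrahomogeneous U }.

End urysohn.

Section distance.
Context (R : realType) (U : completeMetricType R).

(* The plans live on the Borel sigma-algebra of the product topology. *)
Definition couplings (mu nu : probability (borel U) R) :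
    set (probability (borel (U * U)%type) R) :=
  [set pi | forall A : set (borel U), measurable A ->
     pi (fst @^-1` A) = mu A /\ pi (snd @^-1` A) = nu A].

Definition W (mu nu : probability (borel U) R) : \bar R :=
  ereal_inf [set (\int[pi]_p (Num.min (mdist (p : U * U).1 p.2) 1)%:E)%E
            | pi in couplings mu nu].

Definition sim_class (mu : probability (borel U) R) :
    set (probability (borel U) R) :=
  [set nu | measure_isomorphic mu nu].

Definition Psim := {theta : set (probability (borel U) R) | range sim_class theta}.

Definition to_Psim (mu : probability (borel U) R) : Psim :=
  exist (range sim_class) (sim_class mu) (ex_intro2 _ _ mu I erefl).

Definition W_H (theta eta : Psim) : \bar R :=
  Order.max
    (ereal_sup [set ereal_inf [set W mu nu | nu in sval eta] | mu in sval theta])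
    (ereal_sup [set ereal_inf [set W mu nu | mu in sval theta] | nu in sval eta]).

Context (hU : urysohn U).

Definition embedding (X : nmms R) : {f : X -> U | isometry f} :=
  cid (urysohn_universal hU (space_separable X)).

Definition representative (C : X1 R) : nmms R := sval (cid2 (svalP C)).

(* The class does not depend on the representative nor on the embedding. *)
Definition Phi (C : X1 R) : Psim :=
  let X := representative C in
  to_Psim (isometry_pushforward (nmeas X) (svalP (embedding X))).

Definition d_mG (C D : X1 R) : \bar R := W_H (Phi C) (Phi D).

End distance.

(* Main.v *)
(* Key lemma: if mu ~ mu', then for every nu and e > 0 there is an isometric
   bijection psi of U with W(mu', psi_# nu) <= W(mu, nu) + e. Indeed, the isometry
   phi between the supports need not extend to U, but its restriction to a finite
   set F does, and psi is close to phi on most of the mass when F is almost dense;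
   then push an almost optimal plan forward by phi x psi. Hence
   d_mG([X], [Y]) <= W(i_# m_X, j_# m_Y) for all isometries i, j into U, and
   conversely, for a fixed j, some i attains d_mG([X], [Y]) up to e. Embedding
   everything in U, the theorem becomes the fact that W metrizes weak convergence.
   From weak convergence to W: a continuous partition of unity g_i with small
   pieces yields a plan with density sum_i c_i g_i(x) g_i(y) + u(x) v(y) with
   respect to the product of the two measures. *)

Require Import Defs.
From HB Require Import structures.
From mathcomp Require Import all_boot all_order all_algebra.
From mathcomp Require Import all_classical all_reals all_analysis.
From mathcomp Require Import measurable_realfun lra.
Import Defs.

Set Implicit Arguments.
Unset Strict Implicit.
Unset Printing Implicit Defensive.

Import Order.TTheory GRing.Theory Num.Theory.
Import numFieldNormedType.Exports.

Local Open Scope classical_set_scope.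
Local Open Scope ring_scope.

(** * Borel sets of separable metric spaces *)

(* The missing join instance that makes [borel] usable on products. *)
HB.instance Definition _ (S T : ptopologicalType) := Pointed.on (S * T)%type.

Section metric_spaces.
Context (R : realType).

Lemma mdist_dist_le (T : metricType R) (x y x' y' : T) :
  `|mdist x y - mdist x' y'| <= mdist x x' + mdist y y'.
Proof.
have := metric_triangle x x' y; have := metric_triangle x' y' y.
have := metric_triangle x' x y'; have := metric_triangle x y y'.
rewrite (metric_sym y' y) (metric_sym x' x) ler_norml => *.
by apply/andP; split; lra.
Qed.

Lemma mdist_continuous (T : metricType R) :
  continuous (fun p : T * T => mdist p.1 p.2).
Proof.
move=> p; apply/cvgrPdist_lt => e e0.
have e20 : 0 < e / 2 by rewrite divr_gt0.
exists (ball p.1 (e / 2), ball p.2 (e / 2)).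
  by split; exact: nbhsx_ballx.
move=> q [/=]; rewrite !ballEmdist /= => q1 q2.
apply: (le_lt_trans (mdist_dist_le _ _ _ _)); lra.
Qed.

Lemma exists_invn_lt (e : R) : 0 < e -> exists k : nat, k.+1%:R^-1 < e.
Proof.
move=> e0; exists (Num.truncn e^-1).
rewrite -[ltRHS]invrK ltf_pV2 ?posrE ?invr_gt0//.
by rewrite -Num.Theory.truncn_lt_nat// ?invr_ge0 ltW.
Qed.

Lemma dense_sequence (T : completeMetricType R) : separable T ->
  exists x : nat -> T, forall y (e : R), 0 < e -> exists i, mdist (x i) y < e.
Proof.
move=> [D cD dD].
have [p Dp] : D !=set0.
  have [z [_ Dz]] := dD setT (ex_intro _ point I) openT; by exists z.
have /pfcard_geP[D0|[f]] := cD; first by rewrite D0 in Dp.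
exists f => y e e0.
have [|z [zB Dz]] := dD (ball y e)° _ (@open_interior _ _).
  exists y; exact: nbhsx_ballx.
have [i _ fi] := @surj _ _ _ _ f z Dz.
exists i; rewrite fi metric_sym.
by move/interior_subset : zB; rewrite ballEmdist.
Qed.

Lemma open_mdist_ball (T : metricType R) (x : T) (e : R) :
  open [set y | mdist x y < e].
Proof.
rewrite openE => y /= xy; rewrite /interior.
apply/metricType_numDomainType.nbhs_mdistP.
exists (e - mdist x y) => /=; first by rewrite subr_gt0.
move=> z /= yz; apply: (le_lt_trans (metric_triangle x y z)); lra.
Qed.

Lemma open_borel (T : ptopologicalType) (V : set T) :
  open V -> measurable (V : set (borel T)).
Proof. by move=> oV; exact: sub_sigma_algebra. Qed.

Lemma closed_borel (T : ptopologicalType) (V : set T) :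
  closed V -> measurable (V : set (borel T)).
Proof.
by move=> cV; rewrite -[V]setCK; apply: measurableC; apply: open_borel; rewrite openC.
Qed.

Lemma continuous_measurable_real (T : ptopologicalType) (f : T -> R) :
  continuous f -> measurable_fun [set: borel T] (f : borel T -> R).
Proof.
move=> /continuousP cf; apply: (measurability _ (RGenOpens.measurableE R)).
move=> _ [_ [a [b ->] <-]]; rewrite setTI; apply: open_borel.
exact/cf/interval_open.
Qed.

(** By separability an open set of the product is a countable union of products of balls with
    centres in a dense sequence, so it belongs to the product sigma-algebra. This lets measures
    built on the product sigma-algebra serve as plans. *)
Lemma borel_prod_measurable (T : completeMetricType R) : separable T ->
  measurable_fun [set: borel T * borel T]
    (id : borel T * borel T -> borel (T * T)%type).
Proof.
move=> /dense_sequence[x xdense].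
apply: (@measurability _ _ _ (borel (T * T)%type) _ _ (@open (T * T)%type)) => //.
move=> _ [V oV <-]; rewrite setTI preimage_id.
pose B (i : nat) (k : nat) := [set y : T | mdist (x i) y < k.+1%:R^-1].
pose D := [set t : nat * nat * nat | B t.1.1 t.2 `*` B t.1.2 t.2 `<=` V].
have -> : V = \bigcup_(t in D) (B t.1.1 t.2 `*` B t.1.2 t.2).
  apply/seteqP; split => [[a b] Vab|z [t Dt /Dt//]].
  have : nbhs (a, b) V by apply: open_nbhs_nbhs.
  move=> [[P Q] [/= /metricType_numDomainType.nbhs_mdistP[/= d d0 dP]
    /metricType_numDomainType.nbhs_mdistP[/= e e0 eQ]] PQV].
  have [k kde] : exists k : nat, k.+1%:R^-1 < Num.min d e / 2.
    have m0 : 0 < Num.min d e / 2 by rewrite divr_gt0// lt_min d0.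
    exact: exists_invn_lt.
  have k0 : 0 < k.+1%:R^-1 :> R by rewrite invr_gt0.
  have [i ia] := xdense a _ k0; have [j jb] := xdense b _ k0.
  have lt2 (r m c p q s : R) : p < r -> q < r -> r < m / 2 -> m <= c ->
    s <= p + q -> s < c by move=> *; lra.
  have dm : Num.min d e <= d by rewrite ge_min lexx.
  have em : Num.min d e <= e by rewrite ge_min lexx orbT.
  exists ((i, j), k) => //.
  move=> [u v] [iu jv]; apply: PQV.
  have {}iu : mdist (x i) u < k.+1%:R^-1 by exact: iu.
  have {}jv : mdist (x j) v < k.+1%:R^-1 by exact: jv.
  split => /=.
    apply: dP => /=; have := metric_triangle a (x i) u.
    rewrite (metric_sym a (x i)); exact: lt2 ia iu kde dm.
  apply: eQ => /=; have := metric_triangle b (x j) v.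
  rewrite (metric_sym b (x j)); exact: lt2 jb jv kde em.
rewrite bigcup_mkcond; apply: countable_bigcupT_measurable => // t.
case: ifP => // _; apply: measurableX; apply: open_borel; exact: open_mdist_ball.
Qed.

End metric_spaces.

(** * Supports and isomorphic measures *)

Section supports.
Context (R : realType).

Lemma closed_spt (X : completeMetricType R) (m : set (borel X) -> \bar R) :
  (forall A, 0 <= m A)%E -> closed (spt m).
Proof.
move=> m0; rewrite -[spt m]setCK; apply: open_closedC.
rewrite openE => x /= /existsNP[V /not_implyP[oV /not_implyP[Vx mV]]].
apply: (@filterS _ _ _ V); last exact: open_nbhs_nbhs.
by move=> y Vy /(_ V oV Vy).
Qed.

Lemma measurable_spt (X : completeMetricType R)
    (m : {measure set (borel X) -> \bar R}) : measurable (spt m : set (borel X)).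
Proof. by apply: closed_borel; exact: closed_spt. Qed.

(** A point outside the support has a null neighbourhood, which contains a ball around the point
    from a countable family. The null balls of that family therefore cover the complement. *)
Lemma measure_setC_spt (X : completeMetricType R)
    (m : {measure set (borel X) -> \bar R}) : separable X -> m (~` spt m) = 0%E.
Proof.
move=> /dense_sequence[x xdense].
pose B i k := [set y : X | mdist (x i) y < k.+1%:R^-1].
(* Balls of positive mass are replaced by the empty set, so that the union runs over all indices. *)
pose C i k := if m (B i k) == 0%E then B i k else set0.
apply/negligibleP; first by apply: measurableC; exact: measurable_spt.
have : m.-negligible (\bigcup_i \bigcup_k C i k).
  apply: negligible_bigcup => i; apply: negligible_bigcup => k.
  rewrite /C; case: ifPn => [/eqP mB|_]; last exact: negligible_set0.
  by apply/negligibleP => //; apply: open_borel; exact: open_mdist_ball.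
apply: negligibleS => y /= /existsNP[V /not_implyP[oV /not_implyP[Vy mV]]].
have /metricType_numDomainType.nbhs_mdistP[/= e e0 eV] : nbhs y V.
  exact: open_nbhs_nbhs.
have [k ke] := exists_invn_lt (divr_gt0 e0 (ltr0n R 2)).
have k0 : 0 < k.+1%:R^-1 :> R by rewrite invr_gt0.
have [i iy] := xdense y _ k0.
exists i => //; exists k => //; rewrite /C ifT//.
have BV : B i k `<=` V.
  move=> z iz; apply: eV => /=; have := metric_triangle y (x i) z.
  rewrite (metric_sym y (x i)) => /le_lt_trans; apply.
  by rewrite [e]splitr ltrD// (lt_trans _ ke).
rewrite eq_le measure_ge0 andbT.
have mV0 : (m V <= 0)%E by rewrite leNgt; exact/negP.
apply: (le_trans _ mV0); apply: le_measure => //; rewrite inE; apply: open_borel => //.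
exact: open_mdist_ball.
Qed.

Lemma measure_spt_setI (X : completeMetricType R)
    (m : {measure set (borel X) -> \bar R}) (A : set (borel X)) :
  separable X -> measurable A -> m (spt m `&` A) = m A.
Proof.
move=> sX mA; rewrite setIC.
have := measure_setC_spt m sX => m0.
have mS := measurable_spt m.
rewrite [RHS](measureDI m mA mS) -[LHS]add0e; congr (_ + _)%E; apply/esym.
apply: (@subset_measure0 _ _ _ m _ (~` spt m)) => //.
- exact: measurableD.
- exact: measurableC.
Qed.

(** Nothing is known of [phi] outside [D]. On [D] it is continuous, so the preimage of an open set
    is the trace on [D] of an open set [O], here a union of balls centred in [D]. *)
Lemma isometry_on_measurable (X Y : completeMetricType R) (D : set X)
    (phi : X -> Y) (A : set (borel Y)) :
  closed D -> isometry_on D phi -> measurable A ->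
  measurable (D `&` phi @^-1` A : set (borel X)).
Proof.
move=> cD isoD; have mD := closed_borel cD.
suff : measurable_fun (D : set (borel X)) (phi : borel X -> borel Y).
  by move=> h mA; exact: h.
apply: (@measurability _ _ (borel X) (borel Y) _ _ (@open Y)) => //.
move=> _ [V oV <-].
pose O := [set x | exists x0 e,
  [/\ D x0, mdist x0 x < e & forall y, mdist (phi x0) y < e -> V y]].
have -> : D `&` phi @^-1` V = D `&` O.
  apply/seteqP; split => x [Dx].
    move=> Vx; split => //.
    have /metricType_numDomainType.nbhs_mdistP[/= e e0 eV] : nbhs (phi x) V.
      exact: open_nbhs_nbhs.
    by exists x, e; split => //; rewrite mdistxx.
  move=> [x0 [e [Dx0 x0x eV]]]; split => //; apply: eV.
  by rewrite isoD ?inE.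
apply: measurableI => //; apply: open_borel.
have -> : O = \bigcup_(t in [set t : X * R | D t.1 /\
    forall y, mdist (phi t.1) y < t.2 -> V y]) [set x | mdist t.1 x < t.2].
  apply/seteqP; split => [x [x0 [e [? ? ?]]]|x [[x0 e] [/= ? ?] ?]].
    by exists (x0, e).
  by exists x0, e.
by apply: bigcup_open => t _; exact: open_mdist_ball.
Qed.

(** If f(x_n) approaches y, then (x_n) is Cauchy because f preserves distances; by completeness it
    has a limit, which lies in [D] and is sent to y. *)
Lemma closed_isometry_image (X Y : completeMetricType R) (f : X -> Y) (D : set X) :
  isometry f -> closed D -> closed (f @` D).
Proof.
move=> isof cD y cly.
have ex (n : nat) : exists x, D x /\ mdist y (f x) < n.+1%:R^-1.
  have n0 : 0 < n.+1%:R^-1 :> R by rewrite invr_gt0.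
  have [_ [[x Dx <-] xn]] := cly _ (nbhsx_ballx y _ n0).
  by exists x; split => //; move: xn; rewrite ballEmdist.
have [x xP] := choice ex.
have cx : cvg (x @ \oo).
  apply: cauchy_cvg; apply: cauchy_exP => e e0.
  have [k ke] := exists_invn_lt (divr_gt0 e0 (ltr0n R 2)).
  exists (x k); exists k => // n /= kn; rewrite ballEmdist /= -isof.
  apply: (le_lt_trans (metric_triangle _ y _)); rewrite [e]splitr metric_sym.
  apply: ltrD; apply: (lt_trans (xP _).2) => //.
  by apply: le_lt_trans ke; rewrite lef_pV2 ?posrE// ler_nat.
have Dl : D (lim (x @ \oo)).
  apply: (@closed_cvg _ _ \oo _ x D cD _ _ cx); apply: nearW => n; exact: (xP n).1.
exists (lim (x @ \oo)) => //; apply/esym/mdist_positivity/eqP.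
rewrite eq_le mdist_ge0 andbT; apply/ler_addgt0Pl => e e0; rewrite addr0.
have [k ke] := exists_invn_lt (divr_gt0 e0 (ltr0n R 2)).
have /metricType_numDomainType.cvgrPdist_lt/(_ _ (divr_gt0 e0 (ltr0n R 2)))[N _ NP] :=
  cx.
pose n := maxn N k.
apply: (le_trans (metric_triangle _ (f (x n)) _)); rewrite [e]splitr lerD//.
  apply/ltW/(lt_trans (xP _).2)/(le_lt_trans _ ke).
  by rewrite lef_pV2 ?posrE// ler_nat ltnS leq_maxr.
by rewrite isof metric_sym ltW//; apply: NP => /=; rewrite leq_maxl.
Qed.

Lemma isometry_inj (X Y : metricType R) (f : X -> Y) : isometry f -> injective f.
Proof.
by move=> isof x y fxy; apply: mdist_positivity; rewrite -isof fxy mdistxx.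
Qed.

Lemma isometry_comp (X Y Z : metricType R) (f : X -> Y) (g : Y -> Z) :
  isometry f -> isometry g -> isometry (g \o f).
Proof. by move=> isof isog x y; rewrite /= isog. Qed.

(** The point is surjectivity onto the support of the image measure: the image of [spt m] is closed,
    and its complement is open and null, hence contains no point of that support. *)
Lemma measure_isomorphic_pushforward (X Y : completeMetricType R)
    (m : probability (borel X) R) (f : X -> Y) (isof : isometry f) :
  separable X -> measure_isomorphic m (isometry_pushforward m isof).
Proof.
move=> sX; exists f; split.
- split.
  + move=> x mx V oV Vfx; apply: (mx (f @^-1` V)) => //.
    by move/isometry_continuous/continuousP : isof; exact.
  + by move=> x y _ _; exact: isometry_inj.
  + move=> y my; apply: contrapT => yn.
    have cf : closed (f @` spt m).
      by apply: closed_isometry_image => //; exact: closed_spt.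
    have := my _ (closed_openC cf) yn; rewrite lt_neqAle eq_sym => /andP[/eqP + _].
    apply; apply: (@subset_measure0 _ _ _ m _ (~` spt m)).
    * rewrite -[X in measurable X]setTI; apply: (isometry_borel_measurable isof) => //.
      by apply: open_borel; exact: closed_openC.
    * by apply: measurableC; exact: measurable_spt.
    * by move=> x /= h mx; apply: h; exists x.
    * exact: measure_setC_spt.
- by move=> x y _ _; exact: isof.
- move=> A mA; apply: measure_spt_setI => //.
  by rewrite -[X in measurable X]setTI; exact: (isometry_borel_measurable isof).
Qed.

Lemma measure_isomorphic_refl (X : completeMetricType R)
    (m : probability (borel X) R) : separable X -> measure_isomorphic m m.
Proof.
move=> sX; exists id; split => // [|A mA]; last exact: measure_spt_setI.
by split => // x mx; exists x.
Qed.

Lemma measure_isomorphic_sym (X Y : completeMetricType R)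
    (m : probability (borel X) R) (n : probability (borel Y) R) :
  separable X -> measure_isomorphic m n -> measure_isomorphic n m.
Proof.
move=> sX [phi [bphi iphi mphi]].
have cX : closed (spt m) by exact: closed_spt.
have cY : closed (spt n) by exact: closed_spt.
have [psi [mpsi psiK phiK]] : exists psi : Y -> X,
    [/\ forall y, spt n y -> spt m (psi y),
        forall y, spt n y -> phi (psi y) = y &
        forall x, spt m x -> psi (phi x) = x].
  have [fphi inj_phi surj_phi] := bphi.
  have ex y : exists x, spt n y -> spt m x /\ phi x = y.
    (* Outside [spt n] the value of the inverse is irrelevant. *)
    have [ny|nny] := pselect (spt n y); last by exists point.
    by have [x mx <-] := surj_phi _ ny; exists x.
  have [psi psiP] := choice ex.
  exists psi; split => [y /psiP[]//|y /psiP[]//|x mx].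
  have [m1 e1] := psiP _ (fphi _ mx).
  by apply: inj_phi => //; rewrite inE.
have nspt x : spt m x -> spt n (phi x) by case: bphi => + _ _; exact.
have ipsi : isometry_on (spt n) psi.
  move=> x y; rewrite !inE => nx ny.
  by rewrite -{2}(psiK x)// -{2}(psiK y)// iphi// inE; exact: mpsi.
exists psi; split => //.
- split => //.
  + by move=> x y; rewrite !inE => nx ny e; rewrite -(psiK x)// e psiK.
  + by move=> x mx; exists (phi x); [exact: nspt|exact: phiK].
- move=> A mA.
  rewrite -mphi; last exact: isometry_on_measurable.
  rewrite -[RHS](measure_spt_setI _ sX)//; congr (m _).
  apply/seteqP; split => x [mx /=]; first by move=> [_]; rewrite phiK.
  by move=> Ax; split => //; split; [exact: nspt|rewrite /= phiK].
Qed.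

Lemma measure_isomorphic_trans (X Y Z : completeMetricType R)
    (m : probability (borel X) R) (n : probability (borel Y) R)
    (p : probability (borel Z) R) :
  measure_isomorphic m n -> measure_isomorphic n p -> measure_isomorphic m p.
Proof.
move=> [phi [bphi iphi mphi]] [psi [bpsi ipsi mpsi]].
have nspt x : spt m x -> spt n (phi x) by case: bphi => + _ _; exact.
exists (psi \o phi); split.
- exact: set_bij_comp bphi bpsi.
- move=> x y; rewrite !inE => mx my.
  by rewrite /= ipsi ?inE; [rewrite iphi ?inE|exact: nspt|exact: nspt].
- move=> A mA; rewrite -mpsi// -mphi; last first.
    by apply: isometry_on_measurable => //; exact: closed_spt.
  congr (m _); apply/seteqP; split => x [mx /=] => [h|[_]//].
  by split => //; split => //; exact: nspt.
Qed.

(** An isomorphism may fail to be Borel off the support. Making it constant on that null set gives a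
    Borel map on the whole space, along which plans can be pushed forward. *)
Lemma measure_isomorphic_mfun (X Y : completeMetricType R)
    (m : probability (borel X) R) (n : probability (borel Y) R) :
  separable X -> measure_isomorphic m n ->
  exists phi : X -> Y,
    [/\ measurable_fun [set: borel X] (phi : borel X -> borel Y),
        isometry_on (spt m) phi &
        forall A : set (borel Y), measurable A -> m (phi @^-1` A) = n A].
Proof.
move=> sX [phi [_ iphi mphi]].
pose phi' x := if x \in spt m then phi x else point.
have phi'E x : spt m x -> phi' x = phi x by move=> mx; rewrite /phi' mem_set.
have mS := measurable_spt m.
have mphi' : measurable_fun [set: borel X] (phi' : borel X -> borel Y).
  move=> _ A mA; rewrite setTI.
  (* Off the support the preimage is everything or nothing, according to whether [A] contains
     [point]. *)
  have -> : phi' @^-1` A = (spt m `&` phi @^-1` A) `|`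
      (~` spt m `&` (if point \in A then setT else set0)).
    apply/seteqP; split => x /=; rewrite /phi'.
      case: ifPn => [/set_mem|/negP xm Ap]; first by left.
      by right; split; [move=> h; apply: xm; exact: mem_set|rewrite mem_set].
    move=> [[mx Ax]|[mx]]; first by rewrite mem_set.
    by rewrite (memNset mx); case: ifPn => [/set_mem|].
  apply: measurableU.
    by apply: isometry_on_measurable => //; exact: closed_spt.
  by apply: measurableI; [exact: measurableC|case: ifP].
exists phi'; split => //.
- move=> x y; rewrite !inE => mx my; rewrite !phi'E//.
  by apply: iphi; rewrite inE.
- move=> A mA; rewrite -mphi// -[LHS](measure_spt_setI _ sX); last first.
    by rewrite -[X in measurable X]setTI; exact: mphi'.
  congr (m _); apply/seteqP; split => x [mx] /=; rewrite phi'E//.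
Qed.

(** The complements decrease to the empty set by density of the centres, so continuity from above
    applies. It takes the place of a tightness argument. *)
Lemma finite_balls_mass (X : completeMetricType R) (m : probability (borel X) R)
    (x : nat -> X) (r e : R) :
  (forall y (d : R), 0 < d -> exists i, mdist (x i) y < d) -> 0 < r -> 0 < e ->
  exists n : nat, (m (~` [set y | exists2 i, (i < n)%N & (mdist (x i) y < r)%R])
    < e%:E)%E.
Proof.
move=> xdense r0 e0.
pose G n := [set y | exists2 i, (i < n)%N & mdist (x i) y < r].
have GE n : G n = \bigcup_(i in [set i | (i < n)%N]) [set y | mdist (x i) y < r].
  by apply/seteqP; split => [y [i ? ?]|y [i ? ?]]; exists i.
have mG n : measurable (~` G n : set (borel X)).
  apply: measurableC; apply: open_borel; rewrite GE; apply: bigcup_open => i _.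
  exact: open_mdist_ball.
have h : (m \o (fun n => ~` G n)) n @[n --> \oo] --> m (\bigcap_n ~` G n).
  apply: nonincreasing_cvg_mu => //.
  - by rewrite (le_lt_trans (probability_le1 _ _))// ltry.
  - by apply: bigcap_measurable => // n _; exact: mG.
  - move=> a b ab; apply/subsetPset => y /= nb [i ia iy]; apply: nb.
    by exists i => //; exact: leq_trans ab.
have G0 : \bigcap_n ~` G n = set0.
  rewrite -subset0 => y yG; have [i iy] := xdense y r r0.
  by apply: (yG i.+1) => //; exists i.
rewrite G0 measure0 in h.
have [n _ nP] := h _ (open_ereal_lt' (e0 : (0 < e%:E)%E)).
by exists n; exact: (nP n (leqnn n)).
Qed.

End supports.

(** * The transport cost W *)

Section transport_cost.
Context (R : realType).

Lemma measurable_fst_borel (T : completeMetricType R) :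
  measurable_fun [set: borel (T * T)%type] (fst : borel (T * T)%type -> borel T).
Proof.
apply: (@continuous_borel_measurable (T * T)%type T fst) => -[a b].
exact: cvg_fst.
Qed.

Lemma measurable_snd_borel (T : completeMetricType R) :
  measurable_fun [set: borel (T * T)%type] (snd : borel (T * T)%type -> borel T).
Proof.
apply: (@continuous_borel_measurable (T * T)%type T snd) => -[a b].
exact: cvg_snd.
Qed.

Lemma measurable_pair_borel d (X : measurableType d) (T : completeMetricType R)
    (f g : X -> T) : separable T ->
  measurable_fun [set: X] (f : X -> borel T) ->
  measurable_fun [set: X] (g : X -> borel T) ->
  measurable_fun [set: X] ((fun x => (f x, g x)) : X -> borel (T * T)%type).
Proof.
move=> sT mf mg.
apply: (@measurableT_comp _ _ _ _ _ _
  (id : borel T * borel T -> borel (T * T)%type)); first exact: borel_prod_measurable.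
exact: measurable_fun_pair.
Qed.

Definition cost (T : metricType R) (p : T * T) : R := Num.min (mdist p.1 p.2) 1.

Lemma cost_ge0 (T : metricType R) (p : T * T) : 0 <= cost p.
Proof. by rewrite le_min mdist_ge0 ler01. Qed.

Lemma measurable_cost (T : completeMetricType R) :
  measurable_fun [set: borel (T * T)%type] (@cost T : borel (T * T)%type -> R).
Proof.
apply: measurable_minr => //.
by apply: continuous_measurable_real; exact: mdist_continuous.
Qed.

Lemma W_ge0 (T : completeMetricType R) (mu nu : probability (borel T) R) :
  (0 <= W mu nu)%E.
Proof.
apply/ereal_infP => _ [pi _ <-]; apply: integral_ge0 => p _.
by rewrite lee_fin; exact: cost_ge0.
Qed.

(** Every plan is pushed forward by [H]. The truncated cost grows by at most c off the exceptional
    set [B]; on [B] it is at most 1, which adds at most the mass e. Swaps, isometries and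
    isomorphisms of measures are all handled by this estimate. *)
Lemma W_le_pushforward (T S : completeMetricType R)
    (mu nu : probability (borel T) R) (mu' nu' : probability (borel S) R)
    (H : T * T -> S * S) (B : set (borel T)) (c e : R) :
  measurable_fun [set: borel (T * T)%type]
    (H : borel (T * T)%type -> borel (S * S)%type) ->
  (forall pi, couplings mu nu pi -> forall A : set (borel S), measurable A ->
    pi ((fst \o H) @^-1` A) = mu' A /\ pi ((snd \o H) @^-1` A) = nu' A) ->
  measurable B -> (mu B <= e%:E)%E -> 0 <= c ->
  (forall p, ~ B p.1 -> mdist (H p).1 (H p).2 <= mdist p.1 p.2 + c) ->
  (W mu' nu' <= W mu nu + (c + e)%:E)%E.
Proof.
move=> mH Hmarg mB muB c0 HB; rewrite -leeBlDr//.
apply/ereal_infP => _ [pi cpi <-]; rewrite leeBlDr//.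
pose Hf : {mfun borel (T * T)%type >-> borel (S * S)%type} :=
  HB.pack (H : borel (T * T)%type -> borel (S * S)%type)
    (isMeasurableFun.Build _ _ (borel (T * T)%type) (borel (S * S)%type) H mH).
pose pi' : probability (borel (S * S)%type) R := distribution pi Hf.
apply: (@le_trans _ _ (\int[pi']_p (cost (p : S * S))%:E)%E).
  by apply: ereal_inf_lbound; exists pi' => // A mA; exact: Hmarg.
rewrite ge0_integral_distribution; last 2 first.
- by apply/measurable_EFinP; exact: measurable_cost.
- by move=> p; rewrite lee_fin cost_ge0.
have mB' : measurable (fst @^-1` B : set (borel (T * T)%type)).
  by rewrite -[X in measurable X]setTI; exact: measurable_fst_borel.
have mcost := @measurable_cost T.
apply: (@le_trans _ _ (\int[pi]_p ((cost (p : T * T))%:E +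
    (c%:E + (\1_(fst @^-1` B) p)%:E))%E)%E).
  apply: ge0_le_integral => //=.
  - by move=> p _; rewrite lee_fin cost_ge0.
  - apply/measurable_EFinP; apply: (measurableT_comp (@measurable_cost S)) => //.
  - apply: emeasurable_funD; first exact/measurable_EFinP.
    by apply: emeasurable_funD => //; apply/measurable_EFinP; exact: measurable_indic.
  - move=> p _; rewrite -!EFinD lee_fin indicE.
    have [Bp|nBp] := pselect (B p.1).
      rewrite mem_set//= (le_trans (_ : _ <= 1))//; first by rewrite ge_min lexx orbT.
      by rewrite addrA lerDr addr_ge0// cost_ge0.
    rewrite memNset//= addr0 /cost.
    have := HB p nBp; have [d1|d1] := leP (mdist p.1 p.2) 1 => h.
      by rewrite ge_min h.
    by rewrite (le_trans (_ : _ <= 1)) ?lerDl// ge_min lexx orbT.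
rewrite ge0_integralD//=; last 4 first.
- by move=> p _; rewrite lee_fin cost_ge0.
- exact/measurable_EFinP.
- by move=> p _; rewrite -EFinD lee_fin addr_ge0.
- by apply: emeasurable_funD => //; apply/measurable_EFinP; exact: measurable_indic.
rewrite leeD2l// ge0_integralD//=; last first.
  by apply/measurable_EFinP; exact: measurable_indic.
rewrite integral_cst// integral_indic// setIT [X in (_ * X + _)%E]probability_setT mule1.
rewrite EFinD leeD2l//.
by have [piB _] := cpi B mB; move: muB; rewrite -piB.
Qed.

End transport_cost.

(** * Behaviour of W under swaps, isometries and isomorphisms of measures *)

Section transport_of_isomorphic_measures.
Context (R : realType).

Lemma W_sym_le (T : completeMetricType R) (mu nu : probability (borel T) R) :
  separable T -> (W nu mu <= W mu nu)%E.
Proof.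
(* The swap of coordinates costs nothing: c = e = 0 and an empty exceptional set. *)
move=> sT; rewrite -[leRHS]adde0 -[X in (_ + X)%E]/(0%:E) -[X in X%:E](addr0 0).
apply: (@W_le_pushforward _ T T mu nu nu mu (fun p => (p.2, p.1)) set0) => //.
- by apply: measurable_pair_borel => //; [exact: measurable_snd_borel|
    exact: measurable_fst_borel].
- by move=> pi cpi A mA; have [? ?] := cpi A mA.
- by rewrite measure0.
- by move=> p _ /=; rewrite addr0 metric_sym.
Qed.

Lemma W_sym (T : completeMetricType R) (mu nu : probability (borel T) R) :
  separable T -> W nu mu = W mu nu.
Proof. by move=> sT; apply/eqP; rewrite eq_le !W_sym_le. Qed.

Lemma W_isometry_le (T S : completeMetricType R) (mu nu : probability (borel T) R)
    (f : T -> S) (isof : isometry f) : separable S ->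
  (W (isometry_pushforward mu isof) (isometry_pushforward nu isof) <= W mu nu)%E.
Proof.
move=> sS; rewrite -[leRHS]adde0 -[X in (_ + X)%E]/(0%:E) -[X in X%:E](addr0 0).
have mf := isometry_borel_measurable isof.
apply: (@W_le_pushforward _ T S mu nu _ _ (fun p => (f p.1, f p.2)) set0) => //.
- apply: measurable_pair_borel => //.
  + exact: (measurableT_comp mf (@measurable_fst_borel _ T)).
  + exact: (measurableT_comp mf (@measurable_snd_borel _ T)).
- move=> pi cpi A mA.
  have mfA : measurable (f @^-1` A : set (borel T)).
    by rewrite -[X in measurable X]setTI; exact: mf.
  by have [? ?] := cpi _ mfA.
- by rewrite measure0.
- by move=> p _ /=; rewrite addr0 isof.
Qed.

(** If q.1 is in the support and 2e/5-close to a point p of [F], where [psi] agrees with [phi], then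
    going through phi(p) = psi(p) gives d(phi(q.1), psi(q.2)) <= 2 d(q.1, p) + d(q.1, q.2). This
    costs 4e/5, and the points of [mu] without such a p cost e/5 more. *)
Lemma W_isomorphic (U : completeMetricType R) (mu mu' nu : probability (borel U) R)
    (e : R) : separable U -> ultrahomogeneous U -> measure_isomorphic mu mu' ->
  0 < e -> exists psi : U -> U, exists ipsi : isometry psi,
    set_bij setT setT psi /\
    (W mu' (isometry_pushforward nu ipsi) <= W mu nu + e%:E)%E.
Proof.
move=> sU hU mumu' e0.
have [phi [mphi iphi phimu]] := measure_isomorphic_mfun sU mumu'.
have [x xdense] := dense_sequence sU.
have d0 : 0 < e / 5 by lra.
have [n mun] := finite_balls_mass mu xdense d0 d0.
set G := [set y | _] in mun.
(* The centres [x i] may lie off the support, where [phi] is not controlled. They are replaced by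
   support points in the same balls, with a default value when the ball misses the support. *)
have exp i : exists p, forall y, spt mu y -> mdist (x i) y < e / 5 ->
    spt mu p /\ mdist (x i) p < e / 5.
  have [[p [sp ip]]|h] := pselect (exists p, spt mu p /\ mdist (x i) p < e / 5).
    by exists p.
  by exists point => y sy iy; exfalso; apply: h; exists y.
have [p pP] := choice exp.
(* The default values are discarded, so that [phi] is isometric on [F]. *)
pose F := [set z | exists2 i, (i < n)%N & spt mu (p i) /\ z = p i].
have finF : finite_set F.
  apply: (@sub_finite_set _ _ (p @` `I_n)); last exact/finite_image/finite_II.
  by move=> _ [i ilt [_ ->]]; exists i.
have Fspt z : F z -> spt mu z by move=> [i _ [? ->]].
have [|psi [ipsi bpsi psiphi]] := hU F phi finF.
  by move=> a b; rewrite !inE => /Fspt sa /Fspt sb; apply: iphi; rewrite inE.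
exists psi, ipsi; split => //.
have mpsi := isometry_borel_measurable ipsi.
have -> : e = 4 * (e / 5) + e / 5 by lra.
have mG : measurable (G : set (borel U)).
  have -> : G = \bigcup_(i in [set i | (i < n)%N]) [set y | mdist (x i) y < e / 5].
    by apply/seteqP; split => [y [i ? ?]|y [i ? ?]]; exists i.
  by apply: open_borel; apply: bigcup_open => i _; exact: open_mdist_ball.
have mS := measurable_spt mu.
apply: (@W_le_pushforward _ U U mu nu _ _ (fun q => (phi q.1, psi q.2))
    (~` G `|` ~` spt mu)).
- apply: measurable_pair_borel => //.
  + exact: (measurableT_comp mphi (@measurable_fst_borel _ U)).
  + exact: (measurableT_comp mpsi (@measurable_snd_borel _ U)).
- move=> pi cpi A mA; rewrite -phimu//.
  have mphiA : measurable (phi @^-1` A : set (borel U)).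
    by rewrite -[X in measurable X]setTI; exact: mphi.
  have mpsiA : measurable (psi @^-1` A : set (borel U)).
    by rewrite -[X in measurable X]setTI; exact: mpsi.
  by split; [have [] := cpi _ mphiA|have [] := cpi _ mpsiA].
- by apply: measurableU; exact: measurableC.
- rewrite measureU0; [exact: ltW|exact: measurableC|exact: measurableC|].
  exact: measure_setC_spt.
- by lra.
- move=> q /not_orP[/contrapT[i ilt iq] /contrapT sq] /=.
  have [sp ip] := pP i _ sq iq.
  have Fp : F (p i) by exists i.
  have qp : mdist q.1 (p i) <= e / 5 + e / 5.
    rewrite (le_trans (metric_triangle _ (x i) _))//.
    by rewrite lerD// ltW// metric_sym.
  have h1 : mdist (phi q.1) (phi (p i)) = mdist q.1 (p i).
    by rewrite iphi ?inE.
  have h2 : mdist (phi (p i)) (psi q.2) = mdist (p i) q.2.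
    by rewrite -psiphi ?inE// ipsi.
  have := metric_triangle (phi q.1) (phi (p i)) (psi q.2).
  have := metric_triangle (p i) q.1 q.2.
  by rewrite h1 h2 (metric_sym (p i) q.1) => *; lra.
Qed.

End transport_of_isomorphic_measures.

(** * W and weak convergence *)

Section W_convergence_to_weak_convergence.
Context (R : realType).

Lemma bounded_continuous_integrable (T : ptopologicalType)
    (mu : probability (borel T) R) (f : T -> R) (M : R) :
  continuous f -> (forall y, `|f y| <= M) ->
  mu.-integrable [set: borel T] (EFin \o (f : borel T -> R)).
Proof.
move=> cf fM; apply: measurable_bounded_integrable => //.
- by rewrite [X in (X < _)%E]probability_setT ltry.
- exact: continuous_measurable_real.
- by exists M; split; [exact: num_real|move=> r Mr x _; exact: le_trans (fM x) (ltW Mr)].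
Qed.

(** The measures [mu] and [nu] are the images of the plan under the projections, so both integrals
    can be computed against the plan. *)
Lemma integral_coupling (T : completeMetricType R) (mu nu : probability (borel T) R)
    (pi : probability (borel (T * T)%type) R) (f : T -> R) (M : R) :
  couplings mu nu pi -> continuous f -> (forall y, `|f y| <= M) ->
  (`| \int[mu]_y (f y)%:E - \int[nu]_y (f y)%:E | <=
   \int[pi]_p (`|f p.1 - f p.2|)%:E)%E.
Proof.
move=> cpi cf fM.
have cont1 : continuous (fun p : T * T => f p.1).
  by move=> [a b]; apply: (@cvg_comp _ _ _ fst f); [exact: cvg_fst|exact: cf].
have cont2 : continuous (fun p : T * T => f p.2).
  by move=> [a b]; apply: (@cvg_comp _ _ _ snd f); [exact: cvg_snd|exact: cf].
have i1 := @bounded_continuous_integrable _ pi _ M cont1 (fun p => fM p.1).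
have i2 := @bounded_continuous_integrable _ pi _ M cont2 (fun p => fM p.2).
have mf : measurable_fun [set: borel T] (EFin \o (f : borel T -> R)).
  by apply/measurable_EFinP; exact: continuous_measurable_real.
have e1 : (\int[mu]_y (f y)%:E = \int[pi]_p (f p.1)%:E)%E.
  rewrite -(integral_pushforward (@measurable_fst_borel _ T) mf i1 measurableT).
  apply: eq_measure_integral; first exact: measurable_fst_borel.
  by move=> mfst A mA _; have [h _] := cpi A mA; exact: esym h.
have e2 : (\int[nu]_y (f y)%:E = \int[pi]_p (f p.2)%:E)%E.
  rewrite -(integral_pushforward (@measurable_snd_borel _ T) mf i2 measurableT).
  apply: eq_measure_integral; first exact: measurable_snd_borel.
  by move=> msnd A mA _; have [_ h] := cpi A mA; exact: esym h.
rewrite e1 e2 -integralB_EFin//.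
apply: le_trans (le_abse_integral _ _ _) _ => //.
by apply: measurable_int; exact: (integrableB measurableT i1 i2).
Qed.

(** A continuous [f] need not be uniformly continuous. The sets of points at which scale 1/(k+1)
    guarantees oscillation at most e are closed and increase to the whole space, so one of them
    carries almost all the mass. *)
Lemma continuity_modulus_mass (T : completeMetricType R)
    (nu : probability (borel T) R) (f : T -> R) (e d : R) :
  continuous f -> 0 < e -> 0 < d ->
  exists k : nat, exists G : set (borel T),
    [/\ measurable G, (nu (~` G) < d%:E)%E &
        forall x y, G y -> mdist x y < k.+1%:R^-1 -> `|f x - f y| <= e].
Proof.
move=> cf e0 d0.
pose G k := [set y : T | forall x, mdist x y < k.+1%:R^-1 -> `|f x - f y| <= e].
have cG k : closed (G k).
  move=> y cly x xy; apply/ler_addgt0Pr => h h0.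
  have nf : \forall z \near y, `|f y - f z| < h.
    by have /cvgrPdist_lt := cf y; exact.
  have nd : nbhs y [set z | mdist x z < k.+1%:R^-1].
    by apply: open_nbhs_nbhs; split => //; exact: open_mdist_ball.
  have [z [Gz [fyz xz]]] := cly _ (filterI nf nd).
  have := Gz _ xz; move: fyz => /= fyz fxz.
  have -> : f x - f y = (f x - f z) - (f y - f z) by lra.
  by rewrite (le_trans (ler_normB _ _))// lerD// ltW.
have mG k : measurable (~` G k : set (borel T)).
  by apply: measurableC; exact: closed_borel.
have h : (nu \o (fun n => ~` G n)) n @[n --> \oo] --> nu (\bigcap_n ~` G n).
  apply: nonincreasing_cvg_mu => //.
  - by rewrite (le_lt_trans (probability_le1 _ _))// ltry.
  - by apply: bigcap_measurable => // n _; exact: mG.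
  - move=> a b ab; apply/subsetPset => y /= nb Ga; apply: nb => x xy; apply: Ga.
    by rewrite (lt_le_trans xy)// lef_pV2 ?posrE// ler_nat.
have G0 : \bigcap_n ~` G n = set0.
  rewrite -subset0 => y yG.
  have : nbhs y [set x | `|f y - f x| < e] by have /cvgrPdist_lt := cf y; exact.
  move=> /metricType_numDomainType.nbhs_mdistP[/= r r0 rP].
  have [k kr] := exists_invn_lt r0.
  apply: (yG k) => // x xy; rewrite distrC ltW//; apply: rP => /=.
  by rewrite metric_sym (lt_trans xy).
rewrite G0 measure0 in h.
have [k _ kP] := h _ (open_ereal_lt' (d0 : (0 < d%:E)%E)).
exists k, (G k); split; last by move=> x y; exact.
- by rewrite -[G k]setCK; exact: measurableC.
- exact: (kP k (leqnn k)).
Qed.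

(** Under an almost optimal plan, |f(p.1) - f(p.2)| is at most e/3 when p.2 is in [G] and the points
    are close; otherwise it is at most 2M. The set [G] is tested on the second coordinate because
    its law [nu] does not depend on n; distant pairs are controlled by the cost. *)
Lemma W_cvg_weak (T : completeMetricType R) (mu : nat -> probability (borel T) R)
    (nu : probability (borel T) R) :
  W (mu n) nu @[n --> \oo] --> 0%E -> weak_cvg (fun n => mu n) nu.
Proof.
move=> W0 f cf [M0 fM0].
(* The maximum with 1 keeps the divisions by 2M legitimate. *)
pose M := Num.max M0 1.
have M1 : 1 <= M by rewrite le_max lexx orbT.
have fM y : `|f y| <= M by rewrite le_max fM0.
have Mpos : 0 < M by lra.
have fin (m : probability (borel T) R) : (\int[m]_y (f y)%:E)%E \is a fin_num.
  by apply: integrable_fin_num => //; exact: (bounded_continuous_integrable m cf fM).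
rewrite -(fineK (fin nu)); apply/fine_cvgP; split; first by apply: nearW => n; exact: fin.
apply/cvgrPdist_le => e e0.
have e30 : 0 < e / 3 by lra.
have [k [G [mG nuG GP]]] :=
  continuity_modulus_mass nu cf e30 (divr_gt0 e30 (mulr_gt0 (ltr0n R 2) Mpos)).
have K0 : 0 < 2 * M * k.+1%:R by rewrite !mulr_gt0.
have M20 : 0 <= 2 * M by lra.
have K00 := ltW K0.
(* With this bound on the cost, the last term of [h] below integrates to at most e/3. *)
have c0 : 0 < e / 3 / (2 * M * k.+1%:R) by rewrite divr_gt0.
have [N _ NP] := W0 _ (open_ereal_lt' (c0 : (0 < _%:E)%E)).
exists N => // n /= Nn.
have /ereal_inf_lt[_ [pi cpi <-] costpi] := NP _ Nn.
suff h : (`| \int[mu n]_y (f y)%:E - \int[nu]_y (f y)%:E | <= e%:E)%E.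
  by rewrite distrC -lee_fin; move: h; rewrite -(fineK (fin (mu n))) -(fineK (fin nu)).
apply: (le_trans (integral_coupling cpi cf fM)).
have mcost := @measurable_cost R T.
have mB : measurable (snd @^-1` (~` G) : set (borel (T * T)%type)).
  rewrite -[X in measurable X]setTI; apply: measurable_snd_borel => //.
  exact: measurableC.
have mind : measurable_fun [set: borel (T * T)%type]
    (\1_(snd @^-1` (~` G)) : borel (T * T)%type -> R) by exact: measurable_indic.
pose h (p : borel (T * T)%type) : \bar R := ((e / 3)%:E + ((2 * M)%:E *
  (\1_(snd @^-1` (~` G)) p)%:E + (2 * M * k.+1%:R)%:E * (cost (p : T * T))%:E))%E.
apply: (@le_trans _ _ (\int[pi]_p h p)%E).
  apply: ge0_le_integral => //=.
  - apply/measurable_EFinP; apply: measurableT_comp => //.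
    apply: continuous_measurable_real => -[a b].
    apply: (@cvgB _ _ _ _ _ (fun p : T * T => f p.1) (fun p : T * T => f p.2)).
      by apply: (@cvg_comp _ _ _ fst f); [exact: cvg_fst|exact: cf].
    by apply: (@cvg_comp _ _ _ snd f); [exact: cvg_snd|exact: cf].
  - by apply: emeasurable_funD => //; apply: emeasurable_funD;
      apply: emeasurable_funM => //; apply/measurable_EFinP.
  - move=> p _; rewrite /h -!EFinM -!EFinD lee_fin indicE.
    have fd : `|f p.1 - f p.2| <= 2 * M.
      by rewrite (le_trans (ler_normB _ _))// mulr_natl mulr2n lerD.
    have c1 : 0 <= 2 * M * k.+1%:R * cost p by rewrite mulr_ge0 ?cost_ge0// ltW.
    have [Gp|nGp] := pselect (G p.2); last by rewrite mem_set// mulr1; lra.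
    have nGp : ~ (snd @^-1` (~` G)) p by exact.
    rewrite memNset//.
    rewrite mulr0 add0r.
    have [pk|kp] := ltP (mdist p.1 p.2) k.+1%:R^-1.
      by have := GP _ _ Gp pk; lra.
    (* Distant pairs cost at least 1/(k+1); the truncation at 1 is harmless since 1/(k+1) <= 1. *)
    suff : 1 <= k.+1%:R * cost p.
      by move=> h1; have : 2 * M * 1 <= 2 * M * (k.+1%:R * cost p);
        [rewrite ler_pM2l//; lra|lra].
    rewrite mulrC -ler_pdivrMr// div1r le_min kp/=.
    by rewrite invf_le1// ler1n.
rewrite /h ge0_integralD//=; last 3 first.
- by move=> p _; rewrite lee_fin ltW.
- by move=> p _; rewrite -!EFinM -!EFinD lee_fin addr_ge0// mulr_ge0 ?cost_ge0.
- by apply: emeasurable_funD; apply: emeasurable_funM => //; apply/measurable_EFinP.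
rewrite ge0_integralD//=; last 4 first.
- by move=> p _; rewrite -!EFinM lee_fin mulr_ge0.
- by apply: emeasurable_funM => //; apply/measurable_EFinP.
- by move=> p _; rewrite -!EFinM lee_fin mulr_ge0 ?cost_ge0.
- by apply: emeasurable_funM => //; apply/measurable_EFinP.
rewrite integral_cst// [X in (_ * X + _)%E]probability_setT mule1.
rewrite ge0_integralZl_EFin//; last exact/measurable_EFinP.
rewrite ge0_integralZl_EFin//; last 2 first.
- by move=> p _; rewrite lee_fin cost_ge0.
- exact/measurable_EFinP.
rewrite integral_indic// setIT.
have hB : ((2 * M)%:E * pi (snd @^-1` (~` G)) <= (e / 3)%:E)%E.
  have [_ piB] := cpi _ (measurableC mG).
  have -> : e / 3 = 2 * M * (e / 3 / (2 * M)).
    by rewrite [RHS]mulrC divfK// mulf_neq0 ?gt_eqF.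
  rewrite [leRHS]EFinM lee_pmul2l ?lte_fin ?mulr_gt0//.
  by apply: ltW; move: nuG; rewrite -piB.
have hc : ((2 * M * k.+1%:R)%:E * \int[pi]_p (cost (p : T * T))%:E <= (e / 3)%:E)%E.
  have -> : e / 3 = 2 * M * k.+1%:R * (e / 3 / (2 * M * k.+1%:R)).
    by rewrite [RHS]mulrC divfK// gt_eqF.
  by rewrite [leRHS]EFinM lee_pmul2l ?lte_fin//; exact: ltW.
have e3 : e / 3 + (e / 3 + e / 3) = e by lra.
by rewrite -[X in (_ <= X%:E)%E]e3 EFinD EFinD leeD2l// leeD.
Qed.

End W_convergence_to_weak_convergence.

(** * Plans with a density with respect to the product measure *)

Section density_couplings.
Context (R : realType).

Lemma density_probability d (T : measurableType d) (mu : {measure set T -> \bar R})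
    (h : T -> R) :
  measurable_fun [set: T] h -> (forall x, 0 <= h x) ->
  (\int[mu]_x (h x)%:E = 1)%E ->
  exists P : probability T R,
    forall A, measurable A -> P A = (\int[mu]_(x in A) (h x)%:E)%E.
Proof.
move=> mh h0 h1.
pose D (A : set T) := (\int[mu]_(x in A) (h x)%:E)%E.
have D0 : D set0 = 0%E by rewrite /D integral_set0.
have Dge0 A : (0 <= D A)%E by apply: integral_ge0 => x _; rewrite lee_fin.
have Dsigma : semi_sigma_additive D.
  move=> F mF tF mUF; rewrite /D; apply: cvg_toP.
    apply: ereal_nondecreasing_is_cvgn => a b ab.
    by apply: lee_sum_nneg_natr => // k _ _; exact: Dge0.
  rewrite ge0_integral_bigcup//=.
  - by apply: measurable_funTS; apply/measurable_EFinP.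
  - by move=> x _; rewrite lee_fin.
pose mD := isMeasure.Build _ _ _ D D0 Dge0 Dsigma.
pose M : {measure set T -> \bar R} := HB.pack D mD.
pose pD := Measure_isProbability.Build _ _ _ M h1.
pose P : probability T R := HB.pack D mD pD.
by exists P.
Qed.

(** The plan has density sum_k F_k(x) G_k(y) with respect to the product of [mu] and [nu]. The last
    two hypotheses say that integrating out either variable gives 1, which yields the marginals. On
    [B] only the terms in [Q] survive, and term k has total mass a_k b_k. *)
Lemma density_coupling (T : completeMetricType R) (mu nu : probability (borel T) R)
    (n : nat) (F G : 'I_n -> T -> R) (a b : 'I_n -> R) :
  separable T ->
  (forall k, continuous (F k)) -> (forall k, continuous (G k)) ->
  (forall k x, 0 <= F k x) -> (forall k x, 0 <= G k x) ->
  (forall k, (\int[mu]_x (F k x)%:E = (a k)%:E)%E) ->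
  (forall k, (\int[nu]_x (G k x)%:E = (b k)%:E)%E) ->
  (forall x, \sum_k F k x * b k = 1) -> (forall y, \sum_k a k * G k y = 1) ->
  exists2 pi, couplings mu nu pi &
    forall (Q : pred 'I_n) (B : set (borel (T * T)%type)), measurable B ->
      (forall k p, ~~ Q k -> B p -> F k p.1 * G k p.2 = 0) ->
      (pi B <= (\sum_(k | Q k) a k * b k)%:E)%E.
Proof.
move=> sT cF cG F0 G0 intF intG sumF sumG.
have mF k : measurable_fun [set: borel T] (F k : borel T -> R).
  exact: continuous_measurable_real.
have mG k : measurable_fun [set: borel T] (G k : borel T -> R).
  exact: continuous_measurable_real.
(* The density is [h xpredT]; the partial sums serve for the bound on [B]. *)
pose h (Q : pred 'I_n) (p : borel T * borel T) := \sum_(k | Q k) F k p.1 * G k p.2.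
have h0 Q p : 0 <= h Q p by apply: sumr_ge0 => k _; exact: mulr_ge0.
have mh Q : measurable_fun [set: borel T * borel T] (h Q).
  rewrite /h; under eq_fun do rewrite big_mkcond/=.
  apply: measurable_sum => k; case: (Q k) => //.
  by apply: measurable_funM; [exact: (measurableT_comp (mF k) measurable_fst)|
    exact: (measurableT_comp (mG k) measurable_snd)].
have inth1 Q x : (\int[nu]_y (h Q (x, y))%:E = (\sum_(k | Q k) F k x * b k)%:E)%E.
  under eq_integral do rewrite -sumEFin -big_filter.
  rewrite ge0_integral_sum//=; last 2 first.
  - move=> k; apply/measurable_EFinP; apply: measurable_funM => //.
  - by move=> k y _; rewrite lee_fin mulr_ge0.
  rewrite big_filter -sumEFin; apply: eq_bigr => k _.
  under eq_integral do rewrite EFinM.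
  rewrite ge0_integralZl_EFin// ?intG//.
  - by move=> y _; rewrite lee_fin.
  - exact/measurable_EFinP.
have inth2 Q y : (\int[mu]_x (h Q (x, y))%:E = (\sum_(k | Q k) a k * G k y)%:E)%E.
  under eq_integral do rewrite -sumEFin -big_filter.
  rewrite ge0_integral_sum//=; last 2 first.
  - move=> k; apply/measurable_EFinP; apply: measurable_funM => //.
  - by move=> k x _; rewrite lee_fin mulr_ge0.
  rewrite big_filter -sumEFin; apply: eq_bigr => k _.
  under eq_integral do rewrite mulrC EFinM.
  rewrite ge0_integralZl_EFin// ?intF//.
  - by rewrite -EFinM mulrC.
  - by move=> x _; rewrite lee_fin.
  - exact/measurable_EFinP.
have marg1 A : measurable A ->
    (\int[mu \x nu]_(p in fst @^-1` A) (h xpredT p)%:E = mu A)%E.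
  move=> mA; rewrite integral_mkcond epatch_indic.
  rewrite fubini_tonelli1//=; last 2 first.
  - apply: emeasurable_funM; apply/measurable_EFinP => //.
    apply: measurable_indic; rewrite -[X in measurable X]setTI.
    exact: measurable_fst.
  - by move=> p; rewrite mule_ge0// ?lee_fin.
  have -> : mu A = (\int[mu]_x (\1_A x)%:E)%E by rewrite integral_indic// setIT.
  apply: eq_integral => x _.
  rewrite /fubini_F/=.
  under eq_integral => y _.
    rewrite muleC (_ : \1_(fst @^-1` A) (x, y) = \1_A x)//.
    over.
  rewrite ge0_integralZl_EFin//=.
  - by rewrite inth1 sumF mule1.
  - by move=> y _; rewrite lee_fin.
  - apply/measurable_EFinP; exact: measurableT_comp.
have marg2 A : measurable A ->
    (\int[mu \x nu]_(p in snd @^-1` A) (h xpredT p)%:E = nu A)%E.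
  move=> mA; rewrite integral_mkcond epatch_indic.
  rewrite fubini_tonelli2//=; last 2 first.
  - apply: emeasurable_funM; apply/measurable_EFinP => //.
    apply: measurable_indic; rewrite -[X in measurable X]setTI.
    exact: measurable_snd.
  - by move=> p; rewrite mule_ge0// ?lee_fin.
  have -> : nu A = (\int[nu]_y (\1_A y)%:E)%E by rewrite integral_indic// setIT.
  apply: eq_integral => y _.
  rewrite /fubini_G/=.
  under eq_integral => x _.
    rewrite muleC (_ : \1_(snd @^-1` A) (x, y) = \1_A y)//.
    over.
  rewrite ge0_integralZl_EFin//=.
  - by rewrite inth2 sumG mule1.
  - by move=> x _; rewrite lee_fin.
  - apply/measurable_EFinP; exact: measurableT_comp.
have [|P PE] := density_probability (mh xpredT) (h0 xpredT) (mu := (mu \x nu)%E).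
  by rewrite -[X in integral _ X _](preimage_setT fst) marg1// probability_setT.
pose idf : {mfun (borel T * borel T)%type >-> borel (T * T)%type} :=
  HB.pack (id : borel T * borel T -> borel (T * T)%type)
    (isMeasurableFun.Build _ _ (borel T * borel T)%type (borel (T * T)%type) id
      (borel_prod_measurable sT)).
exists (distribution P idf).
  move=> A mA; split.
    transitivity (P (fst @^-1` A)) => //; rewrite PE ?marg1//.
    by rewrite -[X in measurable X]setTI; exact: measurable_fst.
  transitivity (P (snd @^-1` A)) => //; rewrite PE ?marg2//.
  by rewrite -[X in measurable X]setTI; exact: measurable_snd.
move=> Q B mB QB.
have mB' : measurable (B : set (borel T * borel T)).
  by rewrite -[X in measurable X]setTI; exact: (borel_prod_measurable sT).
apply: (@le_trans _ _ (P B)); first by [].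
rewrite PE//.
rewrite (eq_integral (fun p => (h Q p)%:E)); last first.
  move=> p /set_mem Bp; congr EFin; rewrite /h [RHS]big_mkcond/=.
  by apply: eq_bigr => k _; case: ifPn => // nQ; exact: QB.
apply: (@le_trans _ _ (\int[mu \x nu]_p (h Q p)%:E)%E).
  apply: ge0_subset_integral => //.
  - exact/measurable_EFinP.
  - by move=> p _; rewrite lee_fin.
rewrite fubini_tonelli1//=; last 2 first.
- exact/measurable_EFinP.
- by move=> p; rewrite lee_fin.
rewrite /fubini_F; under eq_integral do rewrite inth1 -sumEFin -big_filter.
rewrite ge0_integral_sum//=; last 2 first.
- by move=> k; apply/measurable_EFinP; apply: measurable_funM.
- move=> k x _; rewrite lee_fin mulr_ge0// -lee_fin -intG.
  by apply: integral_ge0 => y _; rewrite lee_fin.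
rewrite big_filter -sumEFin; apply: lee_sum => k _.
under eq_integral do rewrite mulrC EFinM.
rewrite ge0_integralZl_EFin//= ?intF.
- by rewrite -EFinM mulrC.
- by move=> y _; rewrite lee_fin.
- exact/measurable_EFinP.
- by rewrite -lee_fin -intG; apply: integral_ge0 => y _; rewrite lee_fin.
Qed.

End density_couplings.

(** * From weak convergence to convergence in W *)

Section weak_convergence_to_W_convergence.
Context (R : realType).

Lemma cvg_sumr (T : Type) (F : set_system T) (FF : Filter F) (n : nat)
    (f : 'I_n -> T -> R) (l : 'I_n -> R) :
  (forall i, f i x @[x --> F] --> l i) ->
  \sum_i f i x @[x --> F] --> \sum_i l i.
Proof.
move=> fl; apply: (@cvg_big R 'I_n +%R 0 xpredT _ T F (index_enum _) f l FF) => [|i _].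
  by move=> [x y]; apply: cvgD; [exact: cvg_fst|exact: cvg_snd].
exact: fl.
Qed.

(* With a_i and b_i the masses of g_i, each pair of pieces exchanges the mass
   (1 - t) min(a_i, b_i) and the rest is coupled independently; t > 0 keeps the
   remaining mass r away from 0. *)
Lemma W_le_partition (T : completeMetricType R) (mu nu : probability (borel T) R)
    (n : nat) (g : 'I_n.+1 -> T -> R) (a b : 'I_n.+1 -> R) (d t : R) :
  separable T -> (forall i, continuous (g i)) -> (forall i x, 0 <= g i x) ->
  (forall x, \sum_i g i x = 1) ->
  (forall i, (\int[mu]_x (g i x)%:E = (a i)%:E)%E) ->
  (forall i, (\int[nu]_x (g i x)%:E = (b i)%:E)%E) ->
  \sum_i a i = 1 -> \sum_i b i = 1 -> 0 <= d -> 0 < t <= 1 ->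
  (forall i x y, i != ord_max -> d < mdist x y -> g i x * g i y = 0) ->
  (W mu nu <= (d + (b ord_max + (1 - (1 - t) * \sum_i Num.min (a i) (b i))))%:E)%E.
Proof.
move=> sT cg g0 sumg intmu intnu suma sumb d0 /andP[t0 t1] gd.
have a0 i : 0 <= a i.
  by rewrite -lee_fin -intmu; apply: integral_ge0 => x _; rewrite lee_fin.
have b0 i : 0 <= b i.
  by rewrite -lee_fin -intnu; apply: integral_ge0 => x _; rewrite lee_fin.
(* Chosen so that c_i g_i(x) g_i(y) has mass (1 - t) min(a_i, b_i). If a_i or b_i is zero, the
   quotient is zero by convention, and so is the minimum. *)
pose c i := (1 - t) * (Num.min (a i) (b i) / (a i * b i)).
have m0 i : 0 <= Num.min (a i) (b i) by rewrite le_min a0 b0.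
have c0 i : 0 <= c i by rewrite mulr_ge0 ?subr_ge0// divr_ge0 ?mulr_ge0.
have cab i : c i * a i * b i = (1 - t) * Num.min (a i) (b i).
  rewrite /c -!mulrA; congr (_ * _).
  have [a_0|a_0] := eqVneq (a i) 0; first by rewrite a_0 mul0r !mulr0 min_l.
  have [b_0|b_0] := eqVneq (b i) 0; first by rewrite b_0 !mulr0 min_r.
  by rewrite mulVf ?mulr1// mulf_neq0.
have ca1 i : c i * a i <= 1.
  have [b_0|b_0] := eqVneq (b i) 0; first by rewrite /c b_0 mulr0 invr0 !mulr0 mul0r.
  have bp : 0 < b i by rewrite lt_neqAle eq_sym b_0 b0.
  rewrite -(ler_pM2r bp) cab mul1r (le_trans (_ : _ <= Num.min (a i) (b i)))//.
    by rewrite ler_piMl//; lra.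
  by rewrite ge_min lexx orbT.
have cb1 i : c i * b i <= 1.
  have [a_0|a_0] := eqVneq (a i) 0; first by rewrite /c a_0 mul0r invr0 !mulr0 mul0r.
  have ap : 0 < a i by rewrite lt_neqAle eq_sym a_0 a0.
  rewrite -(ler_pM2r ap) mulrAC cab mul1r (le_trans (_ : _ <= Num.min (a i) (b i)))//.
    by rewrite ler_piMl//; lra.
  by rewrite ge_min lexx.
pose r := 1 - (1 - t) * \sum_i Num.min (a i) (b i).
have rE1 : \sum_i (1 - c i * b i) * a i = r.
  under eq_bigr do rewrite mulrBl mul1r mulrAC cab.
  by rewrite sumrB suma -mulr_sumr.
have rE2 : \sum_i (1 - c i * a i) * b i = r.
  under eq_bigr do rewrite mulrBl mul1r cab.
  by rewrite sumrB sumb -mulr_sumr.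
(* In fact r >= t, because the minima sum to at most 1. *)
have r0 : 0 < r.
  have : \sum_i Num.min (a i) (b i) <= 1.
    by rewrite -suma; apply: ler_sum => i _; rewrite ge_min lexx.
  have : 0 <= \sum_i Num.min (a i) (b i) by apply: sumr_ge0.
  rewrite /r; nra.
pose u x := \sum_i (1 - c i * b i) * g i x.
pose v y := \sum_i (1 - c i * a i) / r * g i y.
(* Index 0 carries the remainder u(x) v(y); index i + 1 carries the piece c_i g_i(x) g_i(y). *)
pose F k := if unlift ord0 k is Some i then g i else u.
pose G k := if unlift ord0 k is Some i then fun y => c i * g i y else v.
pose A k := if unlift ord0 k is Some i then a i else r.
pose B k := if unlift ord0 k is Some i then c i * b i else 1.
have mg i : measurable_fun [set: borel T] (g i : borel T -> R).
  exact: continuous_measurable_real.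
have int_lin (m : probability (borel T) R) (al be : 'I_n.+1 -> R) :
    (forall i, 0 <= al i) -> (forall i, (\int[m]_x (g i x)%:E = (be i)%:E)%E) ->
    (\int[m]_x (\sum_i al i * g i x)%:E = (\sum_i al i * be i)%:E)%E.
  move=> al0 intm; under eq_integral do rewrite -sumEFin.
  rewrite ge0_integral_sum//=; last 2 first.
  - by move=> i; apply/measurable_EFinP; exact: measurable_funM.
  - by move=> i x _; rewrite lee_fin mulr_ge0.
  rewrite -sumEFin; apply: eq_bigr => i _.
  under eq_integral do rewrite EFinM.
  rewrite ge0_integralZl_EFin// ?intm//.
  - by move=> x _; rewrite lee_fin.
  - exact/measurable_EFinP.
have cont_lin (al : 'I_n.+1 -> R) : continuous (fun x => \sum_i al i * g i x).
  by move=> x; apply: cvg_sumr => i; apply: cvgM; [exact: cvg_cst|exact: cg].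
have cb0 i : 0 <= 1 - c i * b i by rewrite subr_ge0.
have ca0 i : 0 <= (1 - c i * a i) / r by rewrite divr_ge0 ?(ltW r0)// subr_ge0.
have [||||||||pi cpi piB] := @density_coupling _ T mu nu n.+2 F G A B sT.
- by move=> k; rewrite /F; case: unliftP => [i _|_]; [exact: cg|exact: cont_lin].
- move=> k; rewrite /G; case: unliftP => [i _|_]; last exact: cont_lin.
  by move=> x; apply: cvgM; [exact: cvg_cst|exact: cg].
- move=> k x; rewrite /F; case: unliftP => [i _|_]; first exact: g0.
  by apply: sumr_ge0 => i _; exact: mulr_ge0.
- move=> k x; rewrite /G; case: unliftP => [i _|_]; first exact: mulr_ge0.
  by apply: sumr_ge0 => i _; exact: mulr_ge0.
- move=> k; rewrite /F /A; case: unliftP => [i _|_]; first exact: intmu.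
  by rewrite (int_lin _ _ a)// rE1.
- move=> k; rewrite /G /B; case: unliftP => [i _|_].
    under eq_integral do rewrite EFinM.
    rewrite ge0_integralZl_EFin// ?intnu//.
    + by move=> x _; rewrite lee_fin.
    + exact/measurable_EFinP.
  rewrite (int_lin _ _ b)//; congr EFin.
  under eq_bigr do rewrite mulrAC.
  by rewrite -mulr_suml rE2 divff// gt_eqF.
- move=> x; rewrite big_ord_recl /F /B unlift_none mulr1.
  under eq_bigr do rewrite liftK mulrC.
  rewrite /u -big_split/= -[RHS](sumg x); apply: eq_bigr => i _.
  by rewrite -mulrDl subrK mul1r.
- move=> y; rewrite big_ord_recl /A /G unlift_none.
  under [X in _ + X]eq_bigr do rewrite liftK.
  rewrite /v mulr_sumr -big_split/= -[RHS](sumg y); apply: eq_bigr => i _.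
  have -> : r * ((1 - c i * a i) / r * g i y) = (1 - c i * a i) * g i y.
    by rewrite mulrA [r * _]mulrC divfK ?gt_eqF.
  by rewrite mulrA [a i * _]mulrC -mulrDl subrK mul1r.
apply: (@le_trans _ _ (\int[pi]_p (cost (p : T * T))%:E)%E).
  by apply: ereal_inf_lbound; exists pi.
pose D : set (borel (T * T)%type) := [set p : T * T | d < mdist p.1 p.2].
have mD : measurable D.
  apply: open_borel.
  rewrite (_ : D = (fun p : T * T => mdist p.1 p.2) @^-1` [set x | d < x])//.
  by apply: open_comp => [p _|]; [exact: mdist_continuous|exact: open_gt].
have piD : (pi D <= (b ord_max + r)%:E)%E.
  (* Only the remainder, of mass r, and the last piece, of mass at most [b ord_max], can charge
     pairs at distance more than d. *)
  pose Q : pred 'I_n.+2 := fun k => (k == ord0) || (k == lift ord0 ord_max).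
  apply: (le_trans (piB Q D mD _)).
    move=> k p; rewrite negb_or => /andP[k0 kmax] Dp; rewrite /F /G.
    case: unliftP => [i ki|ki]; last by rewrite ki eqxx in k0.
    rewrite mulrCA gd ?mulr0//.
    by apply: contraNneq kmax => im; rewrite ki im.
  rewrite lee_fin big_mkcond/= big_ord_recl /Q eqxx/= /A /B unlift_none mulr1.
  rewrite addrC lerD2r -big_mkcond/=.
  under eq_bigr do rewrite liftK.
  under eq_bigl do rewrite (inj_eq lift_inj).
  rewrite big_pred1_eq mulrA [a _ * _]mulrC -[leRHS]mul1r.
  by rewrite ler_wpM2r.
apply: (@le_trans _ _ (\int[pi]_p (d%:E + (\1_D p)%:E))%E).
  apply: ge0_le_integral => //=.
  - by move=> p _; rewrite lee_fin cost_ge0.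
  - by apply/measurable_EFinP; exact: measurable_cost.
  - by apply: emeasurable_funD => //; apply/measurable_EFinP; exact: measurable_indic.
  - move=> p _; rewrite -EFinD lee_fin indicE /cost.
    have [Dp|nDp] := ltP d (mdist (p : T * T).1 p.2).
      by rewrite mem_set// ge_min [X in _ || X]ler_wpDl ?orbT.
    rewrite memNset; last by move=> /=; rewrite /D/= ltNge nDp.
    by rewrite addr0 ge_min nDp.
rewrite ge0_integralD//=; last by apply/measurable_EFinP; exact: measurable_indic.
rewrite integral_cst// [X in (_ * X + _)%E]probability_setT mule1 integral_indic// setIT.
by rewrite EFinD leeD2l.
Qed.

Lemma ereal_cvg0 (u : nat -> \bar R) : (forall n, 0 <= u n)%E ->
  (forall e, 0 < e -> \forall n \near \oo, (u n <= e%:E)%E) ->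
  u n @[n --> \oo] --> 0%E.
Proof.
move=> u0 ue.
have fin n e : (u n <= e%:E)%E -> u n \is a fin_num.
  by move=> une; rewrite ge0_fin_numE// (le_lt_trans une)// ltry.
apply/fine_cvgP; split.
  by apply: filterS (ue 1 ltr01) => n; exact: fin.
apply/cvgrPdist_le => e e0; apply: filterS (ue e e0) => n une /=.
rewrite sub0r normrN ger0_norm ?fine_ge0// -lee_fin fineK//; exact: fin une.
Qed.

(** Finitely many balls carry almost all the mass. With bumps s_i on them, the pieces s_i prod_(j <
    i) (1 - s_j) and the leftover prod_(j < n) (1 - s_j) add up to 1 by telescoping. The leftover,
    indexed by [ord_max], vanishes on the balls. *)
Lemma partition_of_unity (T : completeMetricType R) (nu : probability (borel T) R)
    (e : R) : separable T -> 0 < e ->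
  exists (n : nat) (g : 'I_n.+1 -> T -> R),
    [/\ forall i, continuous (g i), forall i x, 0 <= g i x,
        forall x, \sum_i g i x = 1,
        forall i x y, i != ord_max -> e < mdist x y -> g i x * g i y = 0 &
        (\int[nu]_x (g ord_max x)%:E <= e%:E)%E].
Proof.
move=> sT e0.
have [x xdense] := dense_sequence sT.
have r0 : 0 < e / 4 by lra.
have [n nun] := finite_balls_mass nu xdense r0 e0.
set B := [set y | _] in nun.
(* Equal to 1 up to distance e/4 from the centre and to 0 from e/2 on, so two points where it is
   positive are less than e apart. *)
pose s i y := Num.max 0 (Num.min 1 (2 - mdist (x i) y / (e / 4))).
pose rho k y := \prod_(i < k) (1 - s i y).
have s0 i y : 0 <= s i y by rewrite le_max lexx.
have s1 i y : s i y <= 1 by rewrite ge_max ler01 ge_min lexx.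
have rho0 k y : 0 <= rho k y by apply: prodr_ge0 => i _; rewrite subr_ge0.
have rhoS k y : rho k.+1 y = rho k y * (1 - s k y) by rewrite /rho big_ord_recr.
have cs i : continuous (s i).
  move=> y; apply: (@continuous_max R T (cst 0)); first exact: cvg_cst.
  apply: (@continuous_min R T (cst 1)); first exact: cvg_cst.
  apply: cvgB; first exact: cvg_cst.
  apply: cvgM; last exact: cvg_cst.
  apply/cvgrPdist_lt => h h0; apply: filterS (nbhsx_ballx y h h0) => z.
  rewrite ballEmdist /= => yz; apply: le_lt_trans (mdist_dist_le _ _ _ _) _.
  by rewrite mdistxx add0r.
have crho k : continuous (rho k).
  elim: k => [|k IH] y.
    by rewrite /rho; under eq_fun do rewrite big_ord0; exact: cvg_cst.
  rewrite (_ : rho k.+1 = fun z => rho k z * (1 - s k z)); last exact/funext.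
  by apply: cvgM; [exact: IH|apply: cvgB; [exact: cvg_cst|exact: cs]].
have telescope k y : \sum_(i < k) rho i y * s i y + rho k y = 1.
  elim: k => [|k IH]; first by rewrite /rho !big_ord0 add0r.
  by rewrite big_ord_recr/= -[RHS]IH -addrA rhoS -mulrDr subrKC mulr1.
pose g (i : 'I_n.+1) y := if (i < n)%N then rho i y * s i y else rho n y.
have mB : measurable (B : set (borel T)).
  have -> : B = \bigcup_(i in [set i | (i < n)%N]) [set y | mdist (x i) y < e / 4].
    by apply/seteqP; split => [y [i ? ?]|y [i ? ?]]; exists i.
  by apply: open_borel; apply: bigcup_open => i _; exact: open_mdist_ball.
exists n, g; split.
- move=> i y; rewrite /g; case: (i < n)%N; last exact: crho.
  by apply: cvgM; [exact: crho|exact: cs].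
- by move=> i y; rewrite /g; case: ifP => // _; exact: mulr_ge0.
- move=> y; rewrite big_ord_recr /g/= ltnn -[RHS](telescope n y); congr (_ + _).
  by apply: eq_bigr => i _; rewrite ltn_ord.
- move=> i y z imax; rewrite /g ltn_neqAle -ltnS ltn_ord andbT.
  rewrite (_ : (i != n :> nat) = true); last first.
    by apply: contraNneq imax => im; apply/eqP/val_inj.
  have far w : e / 2 <= mdist (x i) w -> s i w = 0.
    move=> ew; apply/max_idPl; rewrite ge_min; apply/orP; right.
    by rewrite subr_le0 ler_pdivlMr//; lra.
  move=> eyz; have [yi|yi] := leP (e / 2) (mdist (x i) y).
    by rewrite (far y yi) mulr0 mul0r.
  rewrite (far z) ?mulr0//; have := metric_triangle y (x i) z.
  by rewrite (metric_sym y (x i)) => *; lra.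
- rewrite /g/= ltnn; apply: (@le_trans _ _ (nu (~` B))); last exact: ltW.
  have mBC : measurable (~` B : set (borel T)) by exact: measurableC.
  have -> : nu (~` B) = (\int[nu]_y (\1_(~` B) y)%:E)%E by rewrite integral_indic// setIT.
  apply: ge0_le_integral => //=.
  + by move=> y _; rewrite lee_fin.
  + by apply/measurable_EFinP; exact: continuous_measurable_real.
  + by apply/measurable_EFinP; exact: measurable_indic.
  + move=> y _; rewrite lee_fin indicE.
    have [By|nBy] := pselect (B y); last first.
      rewrite mem_set//= -(telescope n y) lerDr.
      by apply: sumr_ge0 => i _; exact: mulr_ge0.
    rewrite memNset; last exact.
    have [i ilt iy] := By; rewrite /rho (bigD1 (Ordinal ilt))//=.
    rewrite (_ : s i y = 1) ?subrr ?mul0r//.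
    rewrite /s min_l ?max_r ?ler01//.
    have : mdist (x i) y / (e / 4) <= 1 by rewrite ler_pdivrMr// mul1r ltW.
    by lra.
Qed.

(** The finitely many pieces of a partition of unity adapted to [nu] are bounded continuous test
    functions, so their masses converge and the estimate by partitions applies. *)
Lemma weak_cvg_W (T : completeMetricType R) (mu : nat -> probability (borel T) R)
    (nu : probability (borel T) R) : separable T ->
  weak_cvg (fun n => mu n) nu -> W (mu n) nu @[n --> \oo] --> 0%E.
Proof.
move=> sT weak; apply: ereal_cvg0 => [n|e e0]; first exact: W_ge0.
(* The same e1 bounds the diameters, the mass of the last piece, the difference of the masses and t.
   The total is at most 2 e1 + 1 - (1 - e1)^2 <= 4 e1 <= e; the cap at 1 ensures t <= 1. *)
pose e1 := Num.min (e / 4) 1.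
have e10 : 0 < e1 by rewrite lt_min ltr01 andbT; lra.
have e11 : e1 <= 1 by rewrite ge_min lexx orbT.
have e14 : e1 <= e / 4 by rewrite ge_min lexx.
have [m [g [cg g0 sumg gfar gmax]]] := partition_of_unity nu sT e10.
have g1 i y : `|g i y| <= 1.
  rewrite ger0_norm// -(sumg y) (bigD1 i)//= lerDl.
  by apply: sumr_ge0 => j _; exact: g0.
have intg (P : probability (borel T) R) i :
    (\int[P]_y (g i y)%:E = (fine (\int[P]_y (g i y)%:E))%:E)%E.
  rewrite fineK//; apply: integrable_fin_num => //.
  exact: (bounded_continuous_integrable P (cg i) (g1 i)).
pose mass (P : probability (borel T) R) i := fine (\int[P]_y (g i y)%:E)%E.
have sum_mass P : \sum_i mass P i = 1.
  have mg i : measurable_fun [set: borel T] (g i : borel T -> R).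
    exact: continuous_measurable_real.
  apply: EFin_inj; rewrite -sumEFin; under eq_bigr do rewrite /mass -intg.
  rewrite -ge0_integral_sum//=; last 2 first.
  - by move=> i; exact/measurable_EFinP.
  - by move=> i y _; rewrite lee_fin.
  under eq_integral do rewrite sumEFin sumg.
  by rewrite integral_cst// [X in (_ * X)%E]probability_setT mule1.
have mass_cvg i : mass (mu n) i @[n --> \oo] --> mass nu i.
  have := weak (g i) (cg i) (ex_intro _ 1 (g1 i)).
  by rewrite (intg nu i) => /fine_cvgP[].
have sum0 : \sum_(i < m.+1) `|mass nu i - mass nu i| = 0.
  by under eq_bigr do rewrite subrr normr0; rewrite big1.
have : \sum_i `|mass nu i - mass (mu n) i| @[n --> \oo] -->
    \sum_i `|mass nu i - mass nu i|.
  apply: cvg_sumr => i; apply: (@cvg_norm _ R^o).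
  by apply: (@cvgB _ R^o); [exact: cvg_cst|exact: mass_cvg].
rewrite sum0.
move=> /cvgrPdist_le/(_ _ e10); apply: filterS => n.
rewrite sub0r normrN ger0_norm; last by apply: sumr_ge0.
move=> sum_e1.
apply: (le_trans (@W_le_partition T (mu n) nu m g (mass (mu n)) (mass nu) e1 e1
  sT cg g0 sumg (intg (mu n)) (intg nu) (sum_mass _) (sum_mass _) (ltW e10) _ gfar)).
  by rewrite e10.
have nmax : mass nu ord_max <= e1 by rewrite -lee_fin /mass -intg.
(* Sum the inequality b <= min(a, b) + |b - a| over the pieces. *)
have minP : 1 - e1 <= \sum_i Num.min (mass (mu n) i) (mass nu i).
  rewrite -(sum_mass nu) lerBlDr (le_trans _ (lerD (lexx _) sum_e1))//.
  rewrite -big_split/=; apply: ler_sum => i _.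
  have [_|_] := leP (mass (mu n) i) (mass nu i); last by rewrite lerDl.
  by rewrite -lerBlDl ler_norm.
by rewrite lee_fin; nra.
Qed.

End weak_convergence_to_W_convergence.

(** * The distance of classes *)

Section mG_distance.
Context (R : realType).

(** Used to identify iterated pushforwards with pushforwards along compositions, which agree on
    Borel sets. *)
Lemma W_ext_le (T : completeMetricType R) (mu nu mu' nu' : probability (borel T) R) :
  (forall A : set (borel T), measurable A -> mu' A = mu A) ->
  (forall A : set (borel T), measurable A -> nu' A = nu A) ->
  (W mu' nu' <= W mu nu)%E.
Proof.
move=> muE nuE; apply: ereal_inf_le_tmp => _ [pi cpi <-].
exists pi => // A mA; have [h1 h2] := cpi A mA.
by split; [rewrite muE|rewrite nuE].
Qed.

Section urysohn_space.
Context (U : completeMetricType R) (hU : urysohn U).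

Let sU := urysohn_separable hU.

(** For any mu' in the class of [mu], the image of [nu] under the isometry given by [W_isomorphic]
    stays in the class of [nu] and is a competitor in the infimum. The other half follows by
    symmetry of W. *)
Lemma W_H_le (mu0 nu0 mu nu : probability (borel U) R) :
  measure_isomorphic mu0 mu -> measure_isomorphic nu0 nu ->
  (W_H (to_Psim mu0) (to_Psim nu0) <= W mu nu)%E.
Proof.
move=> mu0mu nu0nu; rewrite /W_H ge_max; apply/andP; split; apply/ereal_supP.
- move=> _ [mu' mu0mu' <-]; apply/lee_addgt0Pr => e e0.
  have mumu' := measure_isomorphic_trans (measure_isomorphic_sym sU mu0mu) mu0mu'.
  have [psi [ipsi [_ Wpsi]]] :=
    W_isomorphic nu sU (urysohn_ultrahomogeneous hU) mumu' e0.
  apply: ge_ereal_inf; eexists; last exact: Wpsi.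
  eexists; last reflexivity.
  exact: measure_isomorphic_trans nu0nu (measure_isomorphic_pushforward _ _ sU).
- move=> _ [nu' nu0nu' <-]; apply/lee_addgt0Pr => e e0.
  have nunu' := measure_isomorphic_trans (measure_isomorphic_sym sU nu0nu) nu0nu'.
  have [psi [ipsi [_ Wpsi]]] :=
    W_isomorphic mu sU (urysohn_ultrahomogeneous hU) nunu' e0.
  apply: ge_ereal_inf; exists (W nu' (isometry_pushforward mu ipsi)).
    exists (isometry_pushforward mu ipsi); last exact: W_sym.
    exact: measure_isomorphic_trans mu0mu (measure_isomorphic_pushforward _ _ sU).
  by rewrite (le_trans Wpsi)// leeD2r// W_sym_le.
Qed.

(** [Phi] depends on a chosen representative and a chosen embedding; all that matters is that the
    resulting measure is isomorphic to that of [X]. *)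
Lemma Phi_to_X1 (X : nmms R) : exists2 mu0 : probability (borel U) R,
  Phi hU (to_X1 X) = to_Psim mu0 & measure_isomorphic (nmeas X) mu0.
Proof.
rewrite /Phi; set Z := representative _.
exists (isometry_pushforward (nmeas Z) (svalP (embedding hU Z))) => //.
have ZX : measure_isomorphic (nmeas Z) (nmeas X).
  have ZE : iso_class Z = iso_class X.
    by rewrite /Z /representative; case: cid2.
  have : iso_class X X by apply: measure_isomorphic_refl; exact: space_separable.
  by rewrite -ZE.
apply: (measure_isomorphic_trans (measure_isomorphic_sym (@space_separable _ Z) ZX)).
by apply: measure_isomorphic_pushforward; exact: space_separable.
Qed.

Lemma d_mG_ge0 (X Y : nmms R) : (0 <= d_mG hU (to_X1 X) (to_X1 Y))%E.
Proof.
rewrite /d_mG /W_H le_max; apply/orP; left.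
have [mu0 -> _] := Phi_to_X1 X; apply: le_ereal_sup_tmp; eexists.
  by exists mu0 => //; exact: measure_isomorphic_refl.
by apply/ereal_infP => _ [nu _ <-]; exact: W_ge0.
Qed.

Lemma d_mG_le (X Y : nmms R) (i : X -> U) (j : Y -> U)
    (isoi : isometry i) (isoj : isometry j) :
  (d_mG hU (to_X1 X) (to_X1 Y) <=
   W (isometry_pushforward (nmeas X) isoi) (isometry_pushforward (nmeas Y) isoj))%E.
Proof.
rewrite /d_mG.
have [mu0 -> Xmu0] := Phi_to_X1 X; have [nu0 -> Ynu0] := Phi_to_X1 Y.
have sX := @space_separable _ X; have sY := @space_separable _ Y.
apply: W_H_le.
- apply: (measure_isomorphic_trans (measure_isomorphic_sym sX Xmu0)).
  exact: measure_isomorphic_pushforward.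
- apply: (measure_isomorphic_trans (measure_isomorphic_sym sY Ynu0)).
  exact: measure_isomorphic_pushforward.
Qed.

Lemma isometry_bij_inverse (psi : U -> U) : isometry psi ->
  set_bij setT setT psi -> exists2 phi : U -> U, isometry phi & cancel psi phi.
Proof.
move=> ipsi [_ _ surj_psi].
have ex y : exists x, psi x = y by have [x _ <-] := surj_psi y I; exists x.
have [phi phiK] := choice ex.
exists phi; first by move=> x y; rewrite -ipsi !phiK.
by move=> x; apply: (isometry_inj ipsi); rewrite phiK.
Qed.

(** The half of W_H that takes the supremum over the second class gives, for the fixed [nu], an
    almost optimal mu isomorphic to the measure of [X]. Passing from mu to an actual image of [X]
    moves [nu] by a bijective isometry, which is then undone by its inverse. Each of the two
    approximations costs e/2. *)
Lemma exists_isometry_W_le (X Y : nmms R) (j : Y -> U) (isoj : isometry j) (e : R) :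
  0 < e -> exists i : X -> U, exists isoi : isometry i,
    (W (isometry_pushforward (nmeas X) isoi) (isometry_pushforward (nmeas Y) isoj)
     <= d_mG hU (to_X1 X) (to_X1 Y) + e%:E)%E.
Proof.
move=> e0; have [k isok] := urysohn_universal hU (@space_separable _ X).
have sX := @space_separable _ X; have sY := @space_separable _ Y.
have [doo|dfin] := eqVneq (d_mG hU (to_X1 X) (to_X1 Y)) +oo%E.
  by exists k, isok; rewrite doo leey.
have e20 : 0 < e / 2 by rewrite divr_gt0.
set nu := isometry_pushforward (nmeas Y) isoj.
have [mu muX Wmu] : exists2 mu : probability (borel U) R,
    measure_isomorphic mu (isometry_pushforward (nmeas X) isok) &
    (W mu nu <= d_mG hU (to_X1 X) (to_X1 Y) + (e / 2)%:E)%E.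
  have d0 := d_mG_ge0 X Y.
  have dfin' : d_mG hU (to_X1 X) (to_X1 Y) \is a fin_num.
    by rewrite ge0_fin_numE// lt_neqAle dfin leey.
  move: dfin'; rewrite /d_mG.
  have [mu0 -> Xmu0] := Phi_to_X1 X; have [nu0 -> Ynu0] := Phi_to_X1 Y => dfin'.
  have : (ereal_inf [set W mu nu | mu in sval (to_Psim mu0)] <
      W_H (to_Psim mu0) (to_Psim nu0) + (e / 2)%:E)%E.
    apply: (@le_lt_trans _ _ (W_H (to_Psim mu0) (to_Psim nu0))); last first.
      by rewrite lteDl// lte_fin.
    rewrite [leRHS]/W_H le_max; apply/orP; right; apply: ereal_sup_ubound.
    exists nu => //; apply: (measure_isomorphic_trans (measure_isomorphic_sym sY Ynu0)).
    exact: measure_isomorphic_pushforward.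
  move=> /ereal_inf_lt[_ [mu mu0mu <-] /ltW Wmu]; exists mu => //.
  apply: (measure_isomorphic_trans (measure_isomorphic_sym sU mu0mu)).
  apply: (measure_isomorphic_trans (measure_isomorphic_sym sX Xmu0)).
  exact: measure_isomorphic_pushforward.
have [psi [ipsi [bpsi Wpsi]]] :=
  W_isomorphic nu sU (urysohn_ultrahomogeneous hU) muX e20.
have [phi iphi psiK] := isometry_bij_inverse ipsi bpsi.
(* Applying the inverse [phi] of [psi] to both measures does not increase W and brings the image of
   [nu] back to [nu]. *)
exists (phi \o k), (isometry_comp isok iphi).
apply: (@le_trans _ _ (W mu nu + (e / 2)%:E)%E); last first.
  by rewrite [e in leRHS]splitr EFinD addeA leeD2r.
apply: le_trans Wpsi; apply: le_trans (W_isometry_le _ _ iphi sU).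
apply: W_ext_le => // A mA.
rewrite -[LHS]/(nu A) -[RHS]/(nu (psi @^-1` (phi @^-1` A))).
by congr (nu _); apply/seteqP; split => y /=; rewrite psiK.
Qed.

End urysohn_space.
End mG_distance.

Theorem theorem4p3 (R : realType) (U : completeMetricType R) (hU : urysohn U)
    (X : nat -> nmms R) (Xoo : nmms R) :
  mG_cvg X Xoo <->
  (d_mG hU (to_X1 (X n)) (to_X1 Xoo) @[n --> \oo] --> 0%E).
Proof.
have sU := urysohn_separable hU.
split => [[Y sY [i [j [isoi [isoj weak]]]]]|d0].
- have WY := weak_cvg_W sY weak.
  (* The common space is embedded in [U]; the composed isometries then bound the distance of the
     classes by W. *)
  have [f isof] := urysohn_universal hU sY.
  apply: (squeeze_cvge (f := cst 0%E) _ (cvg_cst _) WY); apply: nearW => n.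
  rewrite d_mG_ge0/=.
  apply: (le_trans (d_mG_le hU (isometry_comp (isoi n) isof) (isometry_comp isoj isof))).
  apply: le_trans (W_isometry_le _ _ isof sU).
  exact: W_ext_le.
- have [j isoj] := urysohn_universal hU (@space_separable _ Xoo).
  have harm0 n : 0 < n.+1%:R^-1 :> R by rewrite invr_gt0.
  (* [U] itself is the common space: [j] is fixed once and for all, and each [X n] gets its own
     isometry with error 1/(n+1). *)
  have ex n := exists_isometry_W_le hU (X n) isoj (harm0 n).
  pose i n := sval (cid (ex n)).
  have /all_sig[isoi Wi] n := cid (svalP (cid (ex n))).
  exists U => //; exists i, j, isoi, isoj.
  apply: W_cvg_weak.
  apply: (squeeze_cvge (f := cst 0%E) _ (cvg_cst _)
    (_ : d_mG hU (to_X1 (X n)) (to_X1 Xoo) + (n.+1%:R^-1)%:E @[n --> \oo] --> 0%E)%E).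
    by apply: nearW => n; rewrite W_ge0/=; exact: Wi.
  rewrite -[X in _ --> X]adde0; apply: cvgeD => //.
  by apply: cvg_EFin; [exact: nearW|exact: cvg_harmonic].
Qed.
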